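(* Let $n\ge 1$, let $\lambda>0$, and let $\underline a^n_0$ be a (possibly random) vector in $[0,\infty)^n$. Let $(\mathcal G^n_t)_{t\ge 0}$ be a mean field forest fire process with ages $\mathrm{MFFFA}(n,\underline a^n_0,\lambda)$ whose initial graph satisfies $\mathcal G^n_0\stackrel{d}{=}G^{\mathrm{age}}(n,\underline a^n_0)$ (i.e. conditionally on $\underline a^n_0$, the graph $\mathcal G^n_0$ is an age-driven inhomogeneous random graph with ages $\underline a^n_0$), and let $\underline a^n_t=(a^n_t(i))_{i\in[n]}$ be the vector of ages at time $t$. Then for every $t\ge 0$, conditional on $(\underline a^n_s,\ s\in[0,t])$, we have $\mathcal G^n_t\stackrel{d}{=}G^{\mathrm{age}}(n,\underline a^n_t)$. That is, conditional on $(\underline a^n_s)_{0\le s\le t}$, the edges $\{i,j\}\in\binom{[n]}{2}$ are present in $\mathcal G^n_t$ independently of each other, edge $\{i,j\}$ being present with probability $1-\exp\left(-\frac{a^n_t(i)\wedge a^n_t(j)}{n}\right)$.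
   Context: Notation: $[n]=\{1,\dots,n\}$, $x\wedge y=\min(x,y)$. $\mathrm{MFFF}(n,\lambda)$: let $\mathcal E$ be a Poisson point process of rate $1/n$ on $\binom{[n]}{2}\times[0,\infty)$ (edge arrivals) and $\Lambda$ an independent Poisson point process of rate $\lambda$ on $[n]\times[0,\infty)$ (lightning strikes); both are independent of the initial data. Given a (possibly random) initial graph $\mathcal G^n_0$ on $[n]$, the process $(\mathcal G^n_t)_{t\ge0}$ is built by going through the points of $\mathcal E\cup\Lambda$ in increasing order of time: at a point $(\{i,j\},t)$ of $\mathcal E$ the edge $\{i,j\}$ is added if it is not already present; at a point $(i,t)$ of $\Lambda$ all edges of the connected component of $i$ in $\mathcal G^n_{t-}$ are erased, and all vertices of that component are said to be burned at time $t$ (the vertices themselves survive). $\mathrm{MFFFA}(n,\underline a^n_0,\lambda)$: the process $\mathrm{MFFF}(n,\lambda)$ together with initial ages $\underline a^n_0=(a^n_0(i))_{i\in[n]}\in[0,\infty)^n$ and ages $a^n_t(i)$ defined for $t>0$ by: $a^n_t(i)=a^n_0(i)+t$ if $i$ was not burned during $[0,t]$, and otherwise $a^n_t(i)=t-s$ where $s$ is the last burning time of $i$ in $[0,t]$. Age-driven inhomogeneous random graph $G^{\mathrm{age}}(n,\underline a^n)$: for a (possibly random) vector $\underline a^n=(a^n(1),\dots,a^n(n))\in[0,\infty)^n$, this is the random graph on $[n]$ in which, conditional on $\underline a^n$, each edge $\{i,j\}$ is present independently with probability $1-\exp(-(a^n(i)\wedge a^n(j))/n)$. *)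

(* Defs.v *)
From mathcomp Require Import all_boot all_order all_algebra finmap.
From mathcomp Require Import all_classical all_reals all_analysis measurable_realfun.

Set Implicit Arguments.
Unset Strict Implicit.
Unset Printing Implicit Defensive.

Import Order.TTheory GRing.Theory Num.Theory.

Local Open Scope classical_set_scope.
Local Open Scope ring_scope.

(* The unordered pair {i, j} is encoded by its increasing enumeration;
   vertices are numbered from 0. *)
Definition edge (n : nat) := {e : 'I_n * 'I_n | (e.1 < e.2)%N}.

Definition graph (n : nat) := {set edge n}.

Definition adj n (G : graph n) : rel 'I_n :=
  fun i j => [exists e in G, (val e == (i, j)) || (val e == (j, i))].

Definition component n (G : graph n) (i : 'I_n) : {set 'I_n} :=
  [set j | connect (adj G) i j]%SET.

Section PoissonPointProcess.
Context {d : measure_display} {Omega : measurableType d} {R : realType}.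
Variable P : probability Omega R.

(* Measurable subsets of M x [0, oo[, with M finite and discrete *)
Definition marked_measurable (M : finType) (A : set (M * R)) :=
  A `<=` [set x | 0 <= x.2] /\ forall m, measurable (xsection A m).

Definition marked_mean (M : finType) (rate : R) (A : set (M * R)) : \bar R :=
  (rate%:E * \sum_(m : M) lebesgue_measure (xsection A m))%E.

Definition point_count (M : finType) (Pi : Omega -> set (M * R))
  (A : set (M * R)) (w : Omega) : \bar R := counting (Pi w `&` A).

(* The Poisson weights are written out because the library's [poisson_pmf]
   takes the value 1 everywhere at rate 0, whereas sets of mean 0 must carry
   no point almost surely. *)
Definition is_PPP (M : finType) (rate : R) (Pi : Omega -> set (M * R)) :=
  [/\ forall w, Pi w `<=` [set x | 0 <= x.2],
      forall A, marked_measurable A ->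
        measurable_fun [set: Omega] (point_count Pi A),
      forall A, marked_measurable A -> (marked_mean rate A < +oo)%E ->
        forall k : nat,
          P [set w | point_count Pi A w = k%:R%:E] =
          (let m := fine (marked_mean rate A) in
           expR (- m) * m ^+ k / k`!%:R)%:E &
      forall (k : nat) (A : 'I_k -> set (M * R)) (B : 'I_k -> set (\bar R)),
        (forall i, marked_measurable (A i)) -> trivIset setT A ->
        (forall i, measurable (B i)) ->
        P (\bigcap_i (point_count Pi (A i) @^-1` B i)) =
        (\prod_(i < k) P (point_count Pi (A i) @^-1` B i))%E ].

Definition sigma_points (M : finType) (Pi : Omega -> set (M * R)) :
    set (set Omega) :=
  <<s [set H | exists A, marked_measurable A /\
       exists2 B, measurable B & H = point_count Pi A @^-1` B] >>.

End PoissonPointProcess.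

Section Conditioning.
Context {d : measure_display} {Omega : measurableType d} {R : realType}.
Variable P : probability Omega R.

(* [q] is a version of the conditional probability of [A] given [F] *)
Definition is_cond_prob (F : set (set Omega)) (A : set Omega)
    (q : Omega -> R) :=
  [/\ F `<=` measurable, measurable A,
      forall B : set R, measurable B -> F (q @^-1` B) &
      forall H, F H -> P (A `&` H) = (\int[P]_(w in H) (q w)%:E)%E].

Definition age_edge_prob n (a : 'I_n -> R) (e : edge n) : R :=
  1 - expR (- (Num.min (a (val e).1) (a (val e).2) / n%:R)).

(* Given [F], the events [e \in G] are independent, with conditional
   probabilities [age_edge_prob a e]: the product rule holds for every finite
   subfamily, singletons giving the individual probabilities. *)
Definition cond_age_graph n (F : set (set Omega)) (G : Omega -> graph n)
    (a : 'I_n -> Omega -> R) :=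
  forall S : {set edge n},
    is_cond_prob F (\bigcap_(e in [set` S]) [set w | e \in G w])
      (fun w => \prod_(e in S) age_edge_prob (a ^~ w) e).

Definition sigma_ages n (a : 'I_n -> Omega -> R) : set (set Omega) :=
  <<s [set H | exists i, exists2 B, measurable B & H = a i @^-1` B] >>.

Definition sigma_age_history n (a : R -> 'I_n -> Omega -> R) (t : R) :
    set (set Omega) :=
  <<s [set H | exists s i, 0 <= s <= t /\
       exists2 B, measurable B & H = a s i @^-1` B] >>.

Definition sigma_initial n (a0 : 'I_n -> Omega -> R) (G0 : Omega -> graph n) :
    set (set Omega) :=
  <<s [set H | (exists i, exists2 B, measurable B & H = a0 i @^-1` B) \/
               exists g, H = [set w | G0 w = g]] >>.

End Conditioning.

Section Dynamics.
Context {Omega : Type} {R : realType} {n : nat}.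

(* [inl e]: arrival of the edge [e]; [inr i]: lightning at the vertex [i] *)
Definition mark := (edge n + 'I_n)%type.

(* Current graph, and last burning time (if any) of each vertex *)
Definition state := (graph n * {ffun 'I_n -> option R})%type.

Definition step (st : state) (x : mark * R) : state :=
  match x.1 with
  | inl e => ((e |: st.1)%SET, st.2)
  | inr i =>
      let C := component st.1 i in
      ([set e in st.1 | ~~ (((val e).1 \in C) && ((val e).2 \in C))]%SET,
       [ffun j => if j \in C then Some x.2 else st.2 j])
  end.

(* Increasing order of time; simultaneous points, which almost surely do not
   occur, are ordered by their marks, so that no choice of order interferes
   with measurability. *)
Definition time_le : rel (mark * R) := fun x y =>
  (x.2 < y.2) || ((x.2 == y.2) && (enum_rank x.1 <= enum_rank y.1)%N).

(* The points of the two processes in ]0, t] *)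
Definition points_upto (E : Omega -> set (edge n * R))
    (L : Omega -> set ('I_n * R)) (t : R) (w : Omega) : set (mark * R) :=
  ([set (inl x.1, x.2) | x in E w] `|` [set (inr x.1, x.2) | x in L w])
  `&` [set x | 0 < x.2 <= t].

(* [fset_set] enumerates a finite set and is empty on an infinite one; the
   set of points up to time t is almost surely finite. *)
Definition mfff_state (E : Omega -> set (edge n * R))
    (L : Omega -> set ('I_n * R)) (G0 : Omega -> graph n) (t : R) (w : Omega) :
    state :=
  foldl step (G0 w, [ffun=> None])
    (sort time_le (fset_set (points_upto E L t w))).

Definition mfff_graph E L G0 t w : graph n := (mfff_state E L G0 t w).1.

Definition mfffa_age E L G0 (a0 : 'I_n -> Omega -> R) (t : R) (i : 'I_n)
    (w : Omega) : R :=
  if (mfff_state E L G0 t w).2 i is Some s then t - s else a0 i w + t.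

End Dynamics.

(* The driving randomness of MFFFA(n, a0, lambda), with initial graph G0 *)
Definition mfffa_data {d : measure_display} {Omega : measurableType d}
    {R : realType} (P : probability Omega R) (n : nat) (lambda : R)
    (E : Omega -> set (edge n * R)) (L : Omega -> set ('I_n * R))
    (a0 : 'I_n -> Omega -> R) (G0 : Omega -> graph n) : Prop :=
  [/\ is_PPP P n%:R^-1 E, is_PPP P lambda L,
      forall i, measurable_fun [set: Omega] (a0 i) /\ forall w, 0 <= a0 i w,
      forall g, measurable [set w | G0 w = g] &
      forall A B C, sigma_points E A -> sigma_points L B ->
        sigma_initial a0 G0 C ->
        P (A `&` B `&` C) = (P A * P B * P C)%E].

(* Main.v *)
Require Import Defs.
From mathcomp Require Import all_boot all_order all_algebra.
From mathcomp Require Import all_classical all_reals all_analysis measurable_realfun.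
From mathcomp Require Import finmap ring lra.

Set Implicit Arguments.
Unset Strict Implicit.
Unset Printing Implicit Defensive.

Import Order.TTheory GRing.Theory Num.Theory.
Import numFieldNormedType.Exports.

Local Open Scope classical_set_scope.
Local Open Scope ring_scope.

(** The mechanism is that the ages reveal nothing about the present edges beyond
    what the formula for the edge probabilities already contains. Take a graph
    with independent edges and follow it for a while. Letting edges arrive as a
    Poisson process keeps the edges independent and replaces the absence
    probability [exp (- m / n)] of an edge by [exp (- (m + d) / n)], which is
    what growing older by [d] does to the minimum [m] of the two ages. When
    lightning strikes a vertex, the burned component [C] is found by looking
    only at the edges that touch [C]; all of these are then erased, in agreement
    with the age of the vertices of [C] being reset to 0, while the edges away
    from [C] have not been looked at and keep their law ([sum_ber_strike]).
    The ages only depend on the initial ages and on the successive burned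
    components, so induction along the arrivals and strikes gives the conditional
    law of the graph given the whole record of burnings ([coins_law]), and the
    edge probabilities appearing there are those dictated by the ages
    ([matches_grid]).

    To have such an induction at all, time is cut into [N] cells of equal
    length. The events that a given mark has a point in a given cell are
    independent, with explicit probabilities ([hit_law]); combined with the
    conditional law of the initial graph, recovered from the product rule by
    inclusion-exclusion ([cond_graph_law]), this makes the theorem exact for the
    process in which every point is postponed to the end of its cell and several
    points of one mark in one cell count once ([level_law]).

    Almost surely there are finitely many points up to time [t]. Once the mesh is
    finer than the gaps between their times, the discretised process meets the
    same points in the same order: its graph is the true one and its burnings
    are dated at most one mesh too late ([level_near]). Its ages thus converge
    to the true ages from below, so that an event [x < age] is eventually decided
    as in the limit ([level_age_gt_near]), whatever [x] is. Dominated convergence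
    therefore transfers the identity to all finite intersections of such events,
    at times in [[0, t]] ([past_law]). These form a pi-system generating the
    history of the ages, and Dynkin's theorem concludes. The same convergence
    shows that the graph and the ages are measurable. *)

(** * Bernoulli random subsets *)

Section BernoulliSubsets.
Context {R : realType} {T : finType}.
Implicit Types (q : T -> R) (g D S : {set T}).

Definition ber_on D q g : R := \prod_(e in D) (if e \in g then q e else 1 - q e).

(** The law of the random subset containing each [e] with probability [q e],
    independently. *)
Definition ber q g : R := \prod_e (if e \in g then q e else 1 - q e).

Lemma ber_ge0 q g : (forall e, 0 <= q e <= 1) -> 0 <= ber q g.
Proof.
move=> q01; apply: prodr_ge0 => e _; case: ifP => _.
  by case/andP: (q01 e).
by rewrite subr_ge0; case/andP: (q01 e).
Qed.

Lemma ber_split D q g : ber q g = ber_on D q g * ber_on (~: D)%SET q g.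
Proof.
rewrite /ber (bigID (mem D)) /=; congr (_ * _).
by apply: eq_bigl => e; rewrite inE.
Qed.

Lemma eq_ber_on D q q' g g' : {in D, q =1 q'} ->
  (forall e, e \in D -> (e \in g) = (e \in g')) ->
  ber_on D q g = ber_on D q' g'.
Proof. by move=> Eq Eg; apply: eq_bigr => e De; rewrite Eg // Eq. Qed.

Lemma sum_split_subset D (F : {set T} -> R) :
  \sum_g F g =
  \sum_(g1 : {set T} | g1 \subset D) \sum_(g2 : {set T} | g2 \subset ~: D)
    F (g1 :|: g2)%SET.
Proof.
rewrite pair_big_dep /=.
rewrite (reindex_onto (fun p => (p.1 :|: p.2)%SET)
  (fun g => (g :&: D, g :\: D)%SET)) /=; last by move=> g _; rewrite finset.setID.
apply: eq_bigl => -[g1 g2] /=; apply/eqP/andP => [[<- <-]|[s1 s2]].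
  by rewrite finset.setDE !finset.subsetIr.
congr (_, _); apply/setP => e; rewrite !inE; have := fintype.subsetP s1 e;
  have := fintype.subsetP s2 e; rewrite !inE;
  by case: (e \in D); case: (e \in g1); case: (e \in g2) => //= h1 h2;
    try (have := h1 isT); try (have := h2 isT).
Qed.

(** Membership inside [D] and membership outside [D] are independent, so the
    average may be taken over the two parts in turn. *)
Lemma sum_ber_split D q (F : {set T} -> R) :
  \sum_g ber q g * F g =
  \sum_(g1 : {set T} | g1 \subset D) \sum_(g2 : {set T} | g2 \subset ~: D)
    ber_on D q g1 * ber_on (~: D)%SET q g2 * F (g1 :|: g2)%SET.
Proof.
rewrite (sum_split_subset D); apply: eq_bigr => g1 s1; apply: eq_bigr => g2 s2.
rewrite (ber_split D); congr (_ * _ * _); apply: eq_ber_on => // e; rewrite !inE => De.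
  have := fintype.subsetP s2 e; rewrite !inE De /=.
  by case: (e \in g2) => [h|_]; [have := h isT | rewrite orbF].
have := fintype.subsetP s1 e; rewrite (negbTE De).
by case: (e \in g1) => [h|_]; [have := h isT | rewrite orFb].
Qed.

Lemma sum_ber_subset q S : \sum_g ber q g * (S \subset g)%:R = \prod_(e in S) q e.
Proof.
transitivity (\prod_e (q e + (if e \in S then 0 else 1 - q e))); last first.
  rewrite [RHS]big_mkcond; apply: eq_bigr => e _.
  by case: ifP => _; rewrite ?addr0 // addrC subrK.
rewrite bigA_distr; apply: eq_bigr => g _.
have [Sg|] := boolP (S \subset g).
  rewrite mulr1; apply: eq_bigr => e _; case: ifP => // eg.
  by case: ifP => // /(fintype.subsetP Sg); rewrite eg.
case/fintype.subsetPn => e eS eg; rewrite mulr0 (bigD1 e) //= (negbTE eg) eS.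
by rewrite mul0r.
Qed.

Lemma sum_ber q : \sum_g ber q g = 1.
Proof.
have := sum_ber_subset q finset.set0; rewrite big_set0 => <-.
by apply: eq_bigr => g _; rewrite finset.sub0set mulr1.
Qed.

(** Effect on the membership probabilities of deleting [D] from the subset. *)
Definition cut D q : T -> R := fun e => if e \in D then 0 else q e.

Lemma ber_cut D q g :
  ber (cut D q) g = (g \subset ~: D)%:R * ber_on (~: D)%SET q g.
Proof.
have [gD|] := boolP (g \subset ~: D)%SET; last first.
  case/fintype.subsetPn => e eg; rewrite inE negbK => eD.
  by rewrite mul0r /ber (bigD1 e) //= eg /cut eD mul0r.
rewrite mul1r (ber_split D) [X in X * _]big1 ?mul1r; last first.
  move=> e eD; rewrite /cut eD subr0; case: ifP => // /(fintype.subsetP gD).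
  by rewrite inE eD.
by apply: eq_ber_on => // e; rewrite inE /cut => /negbTE ->.
Qed.

(** An event read inside [D] and a function read outside [D] decouple; the
    second factor may be averaged under the law of the subset cut by [D]. *)
Lemma sum_ber_indep D q (A B : {set T} -> R) :
  (forall g, A g = A (g :&: D)%SET) -> (forall g, B g = B (g :\: D)%SET) ->
  \sum_g ber q g * (A g * B g) =
  (\sum_g ber q g * A g) * (\sum_g ber (cut D q) g * B g).
Proof.
move=> hA hB.
have cap1 (g1 g2 : {set T}) : g1 \subset D -> g2 \subset ~: D ->
    ((g1 :|: g2) :&: D = g1 :&: D)%SET.
  move=> s1 s2; rewrite finset.setIUl [X in (_ :|: X)%SET](_ : _ = finset.set0) ?finset.setU0 //.
  by apply/eqP; rewrite finset.setI_eq0 finset.disjoints_subset.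
have cap2 (g1 g2 : {set T}) : g1 \subset D -> g2 \subset ~: D ->
    ((g1 :|: g2) :\: D = g2 :\: D)%SET.
  by move=> s1 s2; rewrite finset.setDUl (eqP (_ : (g1 :\: D == finset.set0)%SET))
    ?finset.set0U // finset.setD_eq0.
have E2 : \sum_g ber (cut D q) g * B g =
    \sum_(g2 : {set T} | g2 \subset ~: D) ber_on (~: D)%SET q g2 * B g2.
  rewrite [RHS]big_mkcond; apply: eq_bigr => g _; rewrite ber_cut.
  by case: ifP => _; rewrite ?mul1r ?mul0r.
have tot D' : \sum_(g1 : {set T} | g1 \subset D') ber_on D' q g1 = 1.
  rewrite -(sum_ber (cut (~: D')%SET q)) [LHS]big_mkcond; apply: eq_bigr => g _.
  by rewrite ber_cut finset.setCK; case: ifP => _; rewrite ?mul1r ?mul0r.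
have E1 : \sum_g ber q g * A g =
    \sum_(g1 : {set T} | g1 \subset D) ber_on D q g1 * A g1.
  rewrite (sum_ber_split D); apply: eq_bigr => g1 s1.
  rewrite -[RHS]mulr1 -(tot (~: D)%SET) big_distrr /=; apply: eq_bigr => g2 s2.
  by rewrite hA cap1 // -hA mulrAC.
rewrite E1 E2 (sum_ber_split D) big_distrl /=; apply: eq_bigr => g1 s1.
rewrite big_distrr /=; apply: eq_bigr => g2 s2.
by rewrite hA cap1 // -hA hB cap2 // -hB mulrACA.
Qed.

(** Conditioning on the membership of a single element isolates the effect of
    the operations that involve this element only. *)
Lemma sum_ber_resample (e : T) q (F : {set T} -> R) :
  \sum_g ber q g * F g =
  \sum_g ber (cut [set e]%SET q) g *
    (q e * F (e |: g)%SET + (1 - q e) * F (g :\ e)%SET).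
Proof.
(* The presence of [e] and the rest of the subset are independent. *)
have eb (b : bool) : \sum_g ber q g * (((e \in g) == b)%:R *
    F (if b then e |: g else g :\ e)%SET) =
    (if b then q e else 1 - q e) *
    \sum_g ber (cut [set e]%SET q) g * F (if b then e |: g else g :\ e)%SET.
  rewrite (@sum_ber_indep [set e]%SET q (fun g => ((e \in g) == b)%:R)
    (fun g => F (if b then e |: g else g :\ e)%SET)); first last.
  - move=> g; congr F; case: b; apply/setP => x; rewrite !inE.
      by case: (x == e).
    by case: (x == e).
  - by move=> g; rewrite !inE eqxx andbT.
  congr (_ * _).
  have Et : \sum_g ber q g * (e \in g)%:R = q e.
    transitivity (\prod_(f in [set e]%SET) q f); last by rewrite big_set1.
    by rewrite -sum_ber_subset; apply: eq_bigr => g _; rewrite finset.sub1set.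
  case: b; first by rewrite -[RHS]Et; apply: eq_bigr => g _; rewrite eqb_id.
  transitivity (\sum_g ber q g - \sum_g ber q g * (e \in g)%:R); last first.
    by rewrite Et sum_ber.
  rewrite -sumrB; apply: eq_bigr => g _.
  by case: (e \in g); rewrite ?mulr1 ?mulr0 ?subrr ?subr0.
transitivity (\sum_g ber q g * (((e \in g) == true)%:R * F (e |: g)%SET) +
  \sum_g ber q g * (((e \in g) == false)%:R * F (g :\ e)%SET)).
  rewrite -big_split; apply: eq_bigr => g _ /=; rewrite -mulrDr; congr (_ * _).
  case: (boolP (e \in g)) => eg; rewrite /= ?mul1r ?mul0r ?addr0 ?add0r.
    by rewrite (finset.setUidPr _) // finset.sub1set.
  by congr F; apply/setP => x; rewrite !inE; case: eqP => // ->; rewrite (negbTE eg).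
rewrite (eb true) (eb false) !big_distrr -big_split /=.
by apply: eq_bigr => g _; ring.
Qed.

(** Effect on the membership probabilities of adding [e] to the subset with
    probability [p]. *)
Definition boost (e : T) (p : R) q : T -> R :=
  fun f => if f == e then q f + (1 - q f) * p else q f.

(** Splitting off [e] on both sides, only the total weight of the presence of [e]
    matters: it is [q e + (1 - q e) * p] in both cases. *)
Lemma sum_ber_boost (e : T) (p : R) q (F : {set T} -> R) :
  \sum_g ber q g * (p * F (e |: g)%SET + (1 - p) * F g) =
  \sum_g ber (boost e p q) g * F g.
Proof.
rewrite (sum_ber_resample e) [RHS](sum_ber_resample e).
have -> : cut [set e]%SET (boost e p q) = cut [set e]%SET q.
  by apply/funext => f; rewrite /cut /boost inE; case: (f == e).
apply: eq_bigr => g _; congr (_ * _).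
rewrite /boost eqxx !finset.setUA finset.setUid.
have -> : (e |: g :\ e = e |: g)%SET by apply/setP => x; rewrite !inE; case: (x == e).
ring.
Qed.

End BernoulliSubsets.

(** * The dynamics on a finite list of arrivals and strikes *)

Section DiscreteRun.
Context {R : realType} {n : nat}.
Local Notation mark := (@mark n).
Implicit Types (g : graph n) (x : mark) (xs : seq mark) (bs : seq bool).
Implicit Types (C : {set 'I_n}) (q : edge n -> R).

(** The graph component of a step does not depend on the date, which allows the
    whole combinatorial part to be carried out without dates. *)
Definition evolve x g : graph n :=
  match x with
  | inl e => (e |: g)%SET
  | inr i => [set e in g | ~~ (((val e).1 \in component g i) &&
                               ((val e).2 \in component g i))]%SET
  end.

Lemma step_graph (st : @state R n) (x : mark * R) : (step st x).1 = evolve x.1 st.1.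
Proof. by case: x => -[]. Qed.

Definition touching C : {set edge n} :=
  [set e : edge n | ((val e).1 \in C) || ((val e).2 \in C)]%SET.

Lemma touching0 : touching finset.set0 = finset.set0.
Proof. by apply/setP => e; rewrite !inE. Qed.

Lemma adj_sym g : symmetric (adj g).
Proof.
by move=> i j; rewrite /adj; apply: eq_existsb => e; rewrite orbC.
Qed.

Lemma adjP g (e : edge n) : e \in g -> adj g (val e).1 (val e).2.
Proof.
move=> eg; apply/existsP; exists e; rewrite eg /=.
by case: (val e) => a b /=; rewrite eqxx.
Qed.

Lemma component_closed g i j k : adj g j k ->
  (j \in component g i) = (k \in component g i).
Proof.
move=> jk; rewrite !inE; apply/idP/idP => h; apply: connect_trans h _.
  exact: connect1.
by apply: connect1; rewrite adj_sym.
Qed.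

(** An edge of the graph meets a component at both ends or at none. *)
Lemma evolve_strike g i :
  evolve (inr i) g = (g :\: touching (component g i))%SET.
Proof.
apply/setP => e; rewrite !inE andbC; case eg: (e \in g); rewrite ?andbF // !andbT.
have := component_closed i (adjP eg); rewrite !inE => ->.
by rewrite andbb orbb.
Qed.

(** Exploring the component [C] only looks at the edges that touch [C]. *)
Lemma component_touching g i C :
  (component g i == C) = (component (g :&: touching C)%SET i == C).
Proof.
have sub g1 g2 : (forall e, e \in touching (component g1 i) ->
      e \in touching (component g2 i) -> e \in g1 -> e \in g2) ->
    component g1 i \subset component g2 i.
  move=> h.
  have walk p l : l \in component g1 i -> connect (adj g2) i l ->
      path (adj g1) l p -> connect (adj g2) i (last l p).
    elim: p l => //= k p IH l lC il /andP[lk]; apply: IH.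
      by rewrite -(component_closed i lk).
    apply: (connect_trans il); apply: connect1.
    case/existsP: lk => e /andP[eg1 ee]; apply/existsP; exists e; rewrite ee andbT.
    have lC2 : l \in component g2 i by rewrite inE.
    by apply: h => //; rewrite inE; case/orP: ee => /eqP ->; rewrite /= ?lC ?lC2 ?orbT.
  apply/fintype.subsetP => j; rewrite !inE => /connectP[p pp ->].
  by apply: walk => //; rewrite inE connect0.
apply/eqP/eqP => h; apply/eqP; rewrite finset.eqEsubset; apply/andP; split.
- by rewrite -{2}h; apply: sub => e _ _; rewrite inE => /andP[].
- by rewrite -{1}h; apply: sub => e eC _ eg; rewrite inE eg -h.
- by rewrite -h; apply: sub => e _ eC eg; rewrite inE eg -{1}h.
- by rewrite -{1}h; apply: sub => e _ _; rewrite inE => /andP[].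
Qed.

(** The component [C] of the struck vertex only depends on the edges touching
    [C]: given [C], the edges away from [C] keep their law, while those
    touching [C] are erased. *)
Lemma sum_ber_strike q i (F : {set 'I_n} -> graph n -> R) :
  \sum_g ber q g * F (component g i) (evolve (inr i) g) =
  \sum_C (\sum_g ber q g * (component g i == C)%:R) *
    \sum_g ber (cut (touching C) q) g * F C g.
Proof.
transitivity (\sum_C \sum_g ber q g * ((component g i == C)%:R *
    F C (g :\: touching C)%SET)).
  rewrite exchange_big; apply: eq_bigr => g _.
  rewrite evolve_strike (bigD1 (component g i)) //= eqxx mul1r big1 ?addr0 //.
  by move=> C; rewrite eq_sym => /negbTE ->; rewrite mul0r mulr0.
apply: eq_bigr => C _.
rewrite (@sum_ber_indep _ _ (touching C) q (fun g => (component g i == C)%:R)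
   (fun g => F C (g :\: touching C)%SET)) /=; first last.
- by move=> g; congr F; rewrite finset.setDDl finset.setUid.
- by move=> g; rewrite component_touching.
congr (_ * _); apply: eq_bigr => g _; rewrite ber_cut.
have [gD|] := boolP (g \subset ~: touching C)%SET; last by rewrite !mul0r.
congr (_ * F C _); rewrite finset.setDE.
exact: (finset.setIidPl gD).
Qed.

(** Expectation of [F] over independent coins, one for each mark, that decide
    whether the mark is effective. The recursive form is the one along which the
    induction of [coins_law] proceeds. *)
Fixpoint coins (p : mark -> R) xs (F : seq bool -> R) : R :=
  if xs is x :: xs' then
    p x * coins p xs' (fun bs => F (true :: bs)) +
    (1 - p x) * coins p xs' (fun bs => F (false :: bs))
  else F [::].

(** The vertices burned at each mark. Together with the initial ages, this
    record determines the ages, and it is all that they reveal of the graph. *)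
Definition burnt x (b : bool) g : {set 'I_n} :=
  if x is inr i then if b then component g i else finset.set0 else finset.set0.

Fixpoint trace xs bs g : seq {set 'I_n} :=
  match xs, bs with
  | x :: xs', b :: bs' => burnt x b g :: trace xs' bs' (if b then evolve x g else g)
  | _, _ => [::]
  end.

Definition final xs bs g : graph n := foldl (fun g x => evolve x g) g (mask bs xs).

(** The edge probabilities given the record of burnings: they grow whenever an
    edge gets an opportunity to appear, and vanish next to burned vertices. *)
Definition next_prob (p : mark -> R) q (xC : mark * {set 'I_n}) : edge n -> R :=
  match xC.1 with
  | inl e => boost e (p xC.1) q
  | inr _ => cut (touching xC.2) q
  end.

Definition final_prob (p : mark -> R) q xs (tr : seq {set 'I_n}) : edge n -> R :=
  foldl (next_prob p) q (zip xs tr).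

Lemma eq_coins p xs F1 F2 : F1 =1 F2 -> coins p xs F1 = coins p xs F2.
Proof. by move=> /funext ->. Qed.

Lemma cut0 q : cut finset.set0 q = q.
Proof. by apply/funext => e; rewrite /cut inE. Qed.

(** Discrete form of the theorem: the arbitrary function [Phi] of the record
    expresses the conditioning. The induction absorbs the first mark into the
    law of the initial graph, which is again of the form [ber]: by
    [sum_ber_boost] for an arrival, and by [sum_ber_strike] for an effective
    strike, once the burned component has been recorded. *)
Lemma coins_law p xs q (Phi : seq {set 'I_n} -> R) (S : {set edge n}) :
  \sum_g ber q g * coins p xs (fun bs =>
     Phi (trace xs bs g) * (S \subset final xs bs g)%:R) =
  \sum_g ber q g * coins p xs (fun bs =>
     Phi (trace xs bs g) * \prod_(e in S) final_prob p q xs (trace xs bs g) e).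
Proof.
elim: xs q Phi => [|x xs IH] q Phi.
  rewrite /= /final /final_prob /=.
  under eq_bigr do rewrite mulrCA.
  by rewrite -big_distrr /= sum_ber_subset -big_distrl /= sum_ber mul1r.
pose l C := fun g => coins p xs (fun bs =>
  Phi (C :: trace xs bs g) * (S \subset final xs bs g)%:R).
pose r C q' := fun g => coins p xs (fun bs =>
  Phi (C :: trace xs bs g) * \prod_(e in S) final_prob p q' xs (trace xs bs g) e).
case: x => [e|i].
  transitivity (\sum_g ber q g * (p (inl e) * l finset.set0 (e |: g)%SET +
     (1 - p (inl e)) * l finset.set0 g)); first by [].
  rewrite sum_ber_boost.
  transitivity (\sum_g ber (boost e (p (inl e)) q) g *
     r finset.set0 (boost e (p (inl e)) q) g).
    exact: (IH _ (fun tr => Phi (finset.set0 :: tr))).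
  by rewrite -sum_ber_boost.
transitivity (p (inr i) * (\sum_g ber q g * l (component g i) (evolve (inr i) g)) +
   (1 - p (inr i)) * \sum_g ber q g * l finset.set0 g).
  rewrite !big_distrr -big_split /=; apply: eq_bigr => g _.
  by rewrite mulrDr [in LHS]mulrCA [X in _ + X]mulrCA.
transitivity (p (inr i) * (\sum_g ber q g *
     r (component g i) (cut (touching (component g i)) q) (evolve (inr i) g)) +
   (1 - p (inr i)) * \sum_g ber q g * r finset.set0 q g); last first.
  rewrite !big_distrr -big_split /=; apply: eq_bigr => g _.
  rewrite [in RHS]mulrDr [in RHS]mulrCA [X in _ + X]mulrCA.
  by rewrite /r /final_prob /= /next_prob /= touching0 cut0.
congr (_ * _ + _ * _).
  rewrite (sum_ber_strike _ _ (fun C => r C (cut (touching C) q))) sum_ber_strike.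
  apply: eq_bigr => C _; congr (_ * _).
  exact: (IH _ (fun tr => Phi (C :: tr))).
exact: (IH _ (fun tr => Phi (finset.set0 :: tr))).
Qed.

End DiscreteRun.

(** * Ages along the time grid *)

Section Ages.
Context {R : realType} {n : nat}.
Local Notation mark := (@mark n).
Local Notation burns := {ffun 'I_n -> option R}.
Implicit Types (g : graph n) (x : mark) (xs : seq mark) (bs : seq bool).
Implicit Types (C : {set 'I_n}) (q : edge n -> R) (b : burns).
Implicit Types (cs : seq (mark * R)) (tr : seq {set 'I_n}).

Definition burn_step b (xC : (mark * R) * {set 'I_n}) : burns :=
  if xC.1.1 is inr _ then [ffun j => if j \in xC.2 then Some xC.1.2 else b j]
  else b.

Definition burn_times b cs tr : burns := foldl burn_step b (zip cs tr).

Lemma run_graph (st : @state R n) cs bs :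
  (foldl step st (mask bs cs)).1 = final (map fst cs) bs st.1.
Proof.
rewrite /final; elim: cs bs st => [|c cs IH] [|[] bs] st //=.
by rewrite IH step_graph.
Qed.

(** Since the last burning times can be read off the record of burnings, they
    may be used as observables in [coins_law]. The suffix [xs] accounts for
    looking at an intermediate time of a longer run. *)
Lemma run_burns (st : @state R n) cs xs bs :
  (foldl step st (mask bs cs)).2 =
  burn_times st.2 cs (trace (map fst cs ++ xs) bs st.1).
Proof.
rewrite /burn_times; elim: cs bs st => [|c cs IH] bs st.
  by rewrite mask0 /=; case: (trace _ _ _).
case: bs => [|b bs] //=.
case: b => /=; rewrite IH; congr foldl.
  - by rewrite /step /burn_step /=; case: c => -[].
  - by rewrite step_graph.
rewrite /burn_step /=; case: c => -[] //= i r.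
by apply/ffunP => j; rewrite ffunE inE.
Qed.

Lemma size_trace xs bs g : size (trace xs bs g) = minn (size xs) (size bs).
Proof.
elim: xs bs g => [|x xs IH] [|b bs] g //=.
by rewrite IH minnSS.
Qed.

Definition age (a : 'I_n -> R) b (u : R) (i : 'I_n) : R :=
  if b i is Some r then u - r else a i + u.

(** The invariant of the run. Ages have to stay nonnegative for a vertex that has
    just burned to realise the minimum of the ages along its edges. *)
Definition matches (a : 'I_n -> R) q b (u : R) :=
  (forall e, q e = age_edge_prob (age a b u) e) /\ (forall i, 0 <= age a b u i).

Lemma final_prob_cat p q xs ys tr1 tr2 : size xs = size tr1 ->
  final_prob p q (xs ++ ys) (tr1 ++ tr2) =
  final_prob p (final_prob p q xs tr1) ys tr2.
Proof. by move=> s; rewrite /final_prob zip_cat // foldl_cat. Qed.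

Lemma burn_times_cat b cs cs' tr1 tr2 : size cs = size tr1 ->
  burn_times b (cs ++ cs') (tr1 ++ tr2) = burn_times (burn_times b cs tr1) cs' tr2.
Proof. by move=> s; rewrite /burn_times zip_cat // foldl_cat. Qed.

Lemma final_prob_edges p q (es : seq (edge n)) tr : uniq es -> size es = size tr ->
  final_prob p q (map inl es) tr =
  fun e => if e \in es then q e + (1 - q e) * p (inl e) else q e.
Proof.
rewrite /final_prob => ue se; elim: es q tr ue se => [|e es IH] q [|C tr] //=.
move=> /andP[ee ue] [se]; rewrite IH //; apply/funext => f.
rewrite inE /next_prob /boost /=; have [->|] //= := eqVneq f e.
by rewrite (negbTE ee).
Qed.

Lemma burn_times_edges b (es : seq (edge n)) (r : R) tr :
  burn_times b [seq (inl e, r) | e <- es] tr = b.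
Proof. by rewrite /burn_times; elim: es tr => [|e es IH] [|C tr] //=. Qed.

Lemma ageD a b u d i : age a b (u + d) i = age a b u i + d.
Proof. by rewrite /age; case: (b i) => [r|]; ring. Qed.

(** The probabilities that the edge is absent before and that it does not arrive
    during [d] multiply, and their exponents add up. *)
Lemma edge_probD (a : 'I_n -> R) e d :
  age_edge_prob a e + (1 - age_edge_prob a e) * (1 - expR (- (d / n%:R))) =
  age_edge_prob (fun i => a i + d) e.
Proof.
rewrite /age_edge_prob /= -addr_minl [in RHS]mulrDl [in RHS]opprD [in RHS]expRD; ring.
Qed.

(** An edge touching [C] gets probability 0, and one of its ends has age 0. *)
Lemma matches_strike p a q b u i C : matches a q b u ->
  matches a (next_prob p q (inr i, C)) (burn_step b ((inr i, u), C)) u.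
Proof.
move=> [Hq Ha].
have ageE j : age a (burn_step b ((inr i, u), C)) u j =
    if j \in C then 0 else age a b u j.
  by rewrite /age /burn_step /= ffunE; case: ifP => // _; rewrite subrr.
split=> [e|j]; last by rewrite ageE; case: ifP.
rewrite /next_prob /cut /age_edge_prob /= inE !ageE.
have [c1|c1] /= := boolP ((val e).1 \in C).
  rewrite min_l; first by rewrite mul0r oppr0 expR0 subrr.
  by case: ifP.
have [c2|c2] := boolP ((val e).2 \in C); last exact: Hq.
by rewrite min_r // mul0r oppr0 expR0 subrr.
Qed.

Lemma matches_strikes p a q b u (vs : seq 'I_n) tr : size vs = size tr ->
  matches a q b u ->
  matches a (final_prob p q (map inr vs) tr)
    (burn_times b [seq (inr i, u) | i <- vs] tr) u.
Proof.
rewrite /final_prob /burn_times.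
elim: vs q b tr => [|i vs IH] q b [|C tr] //= [s] m.
by apply: IH => //; apply: matches_strike.
Qed.

Lemma enum_mark : enum {: mark} = map inl (enum {: edge n}) ++ map inr (enum 'I_n).
Proof. by rewrite enumT unlock /= /sum_enum -!enumT. Qed.

Variable d : R.
Hypothesis d_ge0 : 0 <= d.

(** Within each cell of the grid, all marks are examined in increasing order of
    rank, hence the edges first; what happens in a cell is dated at its end. *)
Definition block (j : nat) : seq (mark * R) :=
  [seq (x, j.+1%:R * d) | x <- enum {: mark}].

Definition grid (k : nat) : seq (mark * R) := flatten [seq block j | j <- iota 0 k].

Lemma gridS k : grid k.+1 = grid k ++ block k.
Proof. by rewrite /grid -addn1 iotaD map_cat flatten_cat /= cats0. Qed.

Lemma gridD k l : exists cs, grid (k + l) = grid k ++ cs.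
Proof.
exists (flatten [seq block j | j <- iota k l]).
by rewrite /grid iotaD map_cat flatten_cat.
Qed.

(** The arrivals of the block advance the time from one grid point to the next,
    with unchanged burning times; its strikes then all take place at the new
    grid time. *)
Lemma matches_block p a q b j tr : size tr = size (block j) ->
  (forall e, p (inl e) = 1 - expR (- (d / n%:R))) ->
  matches a q b (j%:R * d) ->
  matches a (final_prob p q (map fst (block j)) tr) (burn_times b (block j) tr)
    (j.+1%:R * d).
Proof.
move=> + pE m.
have [es [ues mes Ees]] : exists es : seq (edge n),
    [/\ uniq es, forall e, e \in es & enum {: edge n} = es].
  by exists (enum {: edge n}); split=> // [|e]; rewrite ?enum_uniq // mem_enum.
have [vs Evs] : exists vs : seq 'I_n, enum 'I_n = vs by exists (enum 'I_n).
have -> : block j = [seq (inl e, j.+1%:R * d) | e <- es] ++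
    [seq (inr i, j.+1%:R * d) | i <- vs].
  by rewrite /block enum_mark Ees Evs map_cat -!map_comp.
move=> s; rewrite -(cat_take_drop (size es) tr).
have sk : size (take (size es) tr) = size es.
  by apply: size_takel; rewrite s size_cat !size_map leq_addr.
have sd : size (drop (size es) tr) = size vs.
  by rewrite size_drop s size_cat !size_map addKn.
rewrite map_cat -!map_comp /comp /= final_prob_cat ?size_map ?sk //.
rewrite burn_times_cat ?size_map ?sk // burn_times_edges.
apply: matches_strikes; first by rewrite sd.
have [Hq Ha] := m; rewrite final_prob_edges ?sk //.
rewrite -addn1 natrD mulrDl mul1r.
split=> [e|i]; last by rewrite ageD addr_ge0.
rewrite mes pE Hq edge_probD.
suff -> : age a b (j%:R * d + d) = (fun i => age a b (j%:R * d) i + d) by [].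
by apply/funext => i; rewrite ageD.
Qed.

(** The record [tr] is arbitrary here: the agreement between probabilities and
    ages is an algebraic identity, whatever has burned. *)
Lemma matches_grid p a q b k tr : size tr = size (grid k) ->
  (forall e, p (inl e) = 1 - expR (- (d / n%:R))) ->
  matches a q b 0 ->
  matches a (final_prob p q (map fst (grid k)) tr) (burn_times b (grid k) tr)
    (k%:R * d).
Proof.
move=> + pE m; elim: k tr => [|k IH] tr.
  by case: tr => // _; rewrite mul0r.
rewrite gridS size_cat => s; rewrite -(cat_take_drop (size (grid k)) tr).
have st : size (take (size (grid k)) tr) = size (grid k).
  by rewrite size_takel // s leq_addr.
rewrite map_cat final_prob_cat ?size_map ?st // burn_times_cat ?st //.
by apply: matches_block => //; [rewrite size_drop s addKn | exact: IH].
Qed.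

End Ages.

Section GridLaw.
Context {R : realType} {n : nat}.
Local Notation mark := (@mark n).
Local Notation burns := {ffun 'I_n -> option R}.

Lemma eq_coins_size (p : mark -> R) (xs : seq mark) (F1 F2 : seq bool -> R) :
  (forall bs, size bs = size xs -> F1 bs = F2 bs) ->
  coins p xs F1 = coins p xs F2.
Proof.
elim: xs F1 F2 => [|x xs IH] F1 F2 EF /=; first exact: EF.
by congr (_ * _ + _ * _); apply: IH => bs sbs; apply: EF; rewrite /= sbs.
Qed.

(** The coins used along a duplicate-free list may be gathered in one random
    subset. *)
Lemma coins_sum_ber (K : finType) (mk : K -> mark) (p : mark -> R) (c : seq K) F : uniq c ->
  coins p (map mk c) F =
  \sum_(h : {set K}) ber (p \o mk) h * F [seq k \in h | k <- c].
Proof.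
elim: c F => [|k c IH] F /=; first by rewrite -big_distrl /= sum_ber mul1r.
case/andP=> kc uc; rewrite (sum_ber_resample k).
have notin (h h' : {set K}) : (forall k', k' != k -> (k' \in h) = (k' \in h')) ->
    [seq k' \in h | k' <- c] = [seq k' \in h' | k' <- c].
  move=> hh; apply/eq_in_map => k' k'c; apply: hh.
  by apply: contraNneq kc => <-.
have drop X : \sum_(h : {set K}) ber (p \o mk) h * X [seq k' \in h | k' <- c] =
    \sum_(h : {set K}) ber (cut [set k]%SET (p \o mk)) h * X [seq k' \in h | k' <- c].
  rewrite (sum_ber_resample k); apply: eq_bigr => h _; congr (_ * _).
  rewrite (notin (k |: h)%SET h) ?(notin (h :\ k)%SET h).
  - ring.
  - by move=> k' kk'; rewrite !inE kk'.
  - by move=> k' /negbTE kk'; rewrite !inE kk'.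
rewrite !IH // (drop (fun bs => F (true :: bs))) (drop (fun bs => F (false :: bs))).
rewrite !big_distrr -big_split /=; apply: eq_bigr => h _.
rewrite !inE eqxx (notin (k |: h)%SET h) ?(notin (h :\ k)%SET h) /=.
- ring.
- by move=> k' kk'; rewrite !inE kk'.
- by move=> k' /negbTE kk'; rewrite !inE kk'.
Qed.

Definition grid_state (d : R) (k : nat) (bs : seq bool) (g : graph n) : state :=
  foldl step (g, [ffun=> None]) (mask bs (grid d k)).

(** Combination of [coins_law] and [matches_grid]. The function [Phi] observes the
    burning times at all grid points. *)
Lemma grid_coins_law (d : R) (N : nat) (p : mark -> R) (a : 'I_n -> R)
    (Phi : (nat -> burns) -> R) (S : {set edge n}) :
  0 <= d -> (forall i, 0 <= a i) ->
  (forall e, p (inl e) = 1 - expR (- (d / n%:R))) ->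
  \sum_g ber (age_edge_prob a) g * coins p (map fst (grid d N)) (fun bs =>
    Phi (fun k => (grid_state d (minn k N) bs g).2) *
    (S \subset (grid_state d N bs g).1)%:R) =
  \sum_g ber (age_edge_prob a) g * coins p (map fst (grid d N)) (fun bs =>
    Phi (fun k => (grid_state d (minn k N) bs g).2) *
    \prod_(e in S) age_edge_prob (age a (grid_state d N bs g).2 (N%:R * d)) e).
Proof.
move=> d0 a0 pE.
pose bt (tr : seq {set 'I_n}) (k : nat) : burns := burn_times [ffun=> None] (grid d (minn k N)) tr.
have burnsE bs g k : (grid_state d (minn k N) bs g).2 =
    bt (trace (map fst (grid d N)) bs g) k.
  have [cs] := @gridD R n d (minn k N) (N - minn k N); rewrite subnKC ?geq_minr // => ->.
  by rewrite map_cat /grid_state (run_burns _ _ (map fst cs)).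
transitivity (\sum_g ber (age_edge_prob a) g * coins p (map fst (grid d N))
    (fun bs => Phi (bt (trace (map fst (grid d N)) bs g)) *
       (S \subset final (map fst (grid d N)) bs g)%:R)).
  apply: eq_bigr => g _; congr (_ * _); apply: eq_coins => bs.
  by rewrite /grid_state run_graph; congr (Phi _ * _); apply/funext => k; rewrite -burnsE.
rewrite (coins_law _ _ _ (fun tr => Phi (bt tr))).
apply: eq_bigr => g _; congr (_ * _); apply: eq_coins_size => bs sbs.
congr (Phi _ * _); first by apply/funext => k; rewrite -burnsE.
apply: eq_bigr => e _.
have [] := @matches_grid R n d d0 p a (age_edge_prob a) [ffun=> None] N
  (trace (map fst (grid d N)) bs g).
- by rewrite size_trace sbs minnn size_map.
- by [].
- split=> [f|i]; last by rewrite /age ffunE addr0.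
  suff -> : age a [ffun=> None] 0 = a by [].
  by apply/funext => i; rewrite /age ffunE addr0.
by move=> -> _; have := burnsE bs g N; rewrite minnn /bt minnn => ->.
Qed.

Lemma grid_age_ge0 (d : R) (N : nat) (a : 'I_n -> R) bs g :
  0 <= d -> (forall i, 0 <= a i) -> size bs = size (grid d N : seq (mark * R)) ->
  forall i, 0 <= age a (grid_state d N bs g).2 (N%:R * d) i.
Proof.
move=> d0 a0 sbs i; rewrite /grid_state (run_burns _ _ [::]) cats0.
have [] := @matches_grid R n d d0 (fun=> 1 - expR (- (d / n%:R))) a
  (age_edge_prob a) [ffun=> None] N (trace (map fst (grid d N)) bs g) => //.
- by rewrite size_trace sbs size_map minnn.
- split=> [f|j]; last by rewrite /age ffunE addr0.
  suff -> : age a [ffun=> None] 0 = a by [].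
  by apply/funext => j; rewrite /age ffunE addr0.
Qed.

End GridLaw.

(** * Conditioning the initial graph and the arrivals *)

Section ConditionalDensity.
Context {d : measure_display} {Omega : measurableType d} {R : realType}.
Variable P : probability Omega R.
Local Open Scope ereal_scope.
Import HBNNSimple.

Lemma measurable_g_sigma (G : set (set Omega)) d' (T : measurableType d') (f : Omega -> T) :
  <<s G>> `<=` measurable ->
  measurable_fun [set: g_sigma_algebraType G] (f : g_sigma_algebraType G -> T) ->
  measurable_fun [set: Omega] f.
Proof. by move=> GF mf mT B mB; apply: GF; exact: mf. Qed.

(** The defining property of a conditional probability [k] of [A] extends from
    events to nonnegative observables of the conditioning sigma-algebra, through
    simple functions and monotone convergence. *)
Lemma ge0_integral_cond (G : set (set Omega)) (A : set Omega) (k : Omega -> R)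
    (f : Omega -> R) :
  <<s G>> `<=` measurable -> measurable A ->
  measurable_fun [set: Omega] k -> (forall w, 0 <= k w)%R ->
  (forall H, <<s G>> H -> P (A `&` H) = \int[P]_(w in H) (k w)%:E) ->
  measurable_fun [set: g_sigma_algebraType G] (f : g_sigma_algebraType G -> R) ->
  (forall w, 0 <= f w)%R ->
  \int[P]_w (f w * \1_A w)%:E = \int[P]_w (f w * k w)%:E.
Proof.
move=> GF mA mk k0 kE mf f0.
have meas (h : {nnsfun (g_sigma_algebraType G) >-> R}) : measurable_fun [set: Omega] h.
  by apply: measurable_g_sigma GF _; exact: measurable_funPT.
have simple (h : {nnsfun (g_sigma_algebraType G) >-> R}) :
    \int[P]_w (h w * \1_A w)%:E = \int[P]_w (h w * k w)%:E.
  pose s := fset_set (h @` setT).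
  have mpre y : <<s G>> (h @^-1` [set y]).
    by have := @measurable_funPT _ _ _ _ h measurableT [set y]; rewrite setTI; apply.
  have s0 (i : 'I_(#|`s|)) : (0 <= s`_i)%R.
    have : s`_i \in s by apply: mem_nth.
    by rewrite in_fset_set //= => /set_mem[x _ <-].
  have E (l : Omega -> R) : measurable_fun [set: Omega] l -> (forall w, 0 <= l w)%R ->
      \int[P]_w (h w * l w)%:E =
      \sum_(i < #|`s|) (s`_i)%:E * \int[P]_(w in h @^-1` [set s`_i]) (l w)%:E.
    move=> ml l0.
    transitivity (\int[P]_w \sum_(i < #|`s|)
        (s`_i)%:E * (\1_(h @^-1` [set s`_i]) w * l w)%:E).
      apply: eq_integral => w _.
      rewrite -[in LHS](_ : (\sum_(i < #|`s|) (s`_i * \1_(h @^-1` [set s`_i]) w))%R = h w);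
        last exact/esym/fimfunEord.
      by rewrite big_distrl -sumEFin; apply: eq_bigr => i _ /=; rewrite -mulrA EFinM.
    rewrite ge0_integral_sum //; last 2 first.
    - move=> i; apply: measurable_funeM; apply/measurable_EFinP.
      apply: measurable_funM => //; apply: measurable_indic; exact: GF.
    - move=> i w _; rewrite mule_ge0 ?lee_fin ?s0 // mulr_ge0 //.
    apply: eq_bigr => i _; rewrite ge0_integralZl_EFin //.
    - congr (_ * _); rewrite [RHS]integral_mkcond; apply: eq_integral => w _.
      by rewrite patchE indicE; case: ifP => _; rewrite ?mul1r ?mul0r.
    - by move=> w _; rewrite lee_fin mulr_ge0.
    - apply/measurable_EFinP; apply: measurable_funM => //.
      by apply: measurable_indic; exact: GF.
  rewrite (E _ mk k0) (E \1_A); [|exact: measurable_indic|by []].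
  apply: eq_bigr => i _; congr (_ * _).
  rewrite integral_indic //; last exact: GF.
  by apply: kE; exact: mpre.
have mfE : measurable_fun [set: g_sigma_algebraType G] (EFin \o f).
  exact/measurable_EFinP.
pose h := nnsfun_approx measurableT mfE.
have lim (l : Omega -> R) : measurable_fun [set: Omega] l -> (forall w, 0 <= l w)%R ->
    \int[P]_w (h m w * l w)%:E @[m --> \oo] --> \int[P]_w (f w * l w)%:E.
  move=> ml l0.
  rewrite [X in _ --> X](_ : _ = \int[P]_w limn (fun m => (h m w * l w)%:E)); last first.
    apply: eq_integral => w _; apply/esym/cvg_lim => //.
    under eq_fun do rewrite EFinM; rewrite EFinM; apply: cvgeMr => //.
    by apply: (cvg_nnsfun_approx measurableT mfE) => // x _; rewrite lee_fin.
  apply: cvg_monotone_convergence => //.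
  - by move=> m; apply/measurable_EFinP; apply: measurable_funM => //; exact: meas.
  - by move=> m w _; rewrite lee_fin mulr_ge0.
  - move=> w _ a b ab; rewrite lee_fin ler_wpM2r //.
    by have /lefP := nd_nnsfun_approx measurableT mfE ab; exact.
have l2 := lim _ mk k0; have l1 : \int[P]_w (h m w * \1_A w)%:E @[m --> \oo] -->
    \int[P]_w (f w * \1_A w)%:E by apply: lim => //; exact: measurable_indic.
apply: (cvg_unique _ l1) => //.
suff -> : (fun m => \int[P]_w (h m w * \1_A w)%:E) =
          (fun m => \int[P]_w (h m w * k w)%:E) by [].
by apply/funext => m; exact: simple.
Qed.

End ConditionalDensity.

Section InclusionExclusion.
Context {R : realType} {T : finType}.
Implicit Types (q : T -> R) (g S G : {set T}).

(** The coefficient of the product of the [q e], for [e] in [S], when the product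
    defining [ber q g] is expanded. *)
Definition moebius g S : R :=
  \prod_e (if e \in S then (if e \in g then 1 else -1) else (e \notin g)%:R).

(** The coefficients do not depend on [q]: applied to the indicator of a graph and
    to the conditional edge probabilities, the same expansion gives both sides
    of [cond_graph_law]. *)
Lemma ber_moebius q g :
  ber q g = \sum_S moebius g S * \prod_(e in S) q e.
Proof.
(* Each factor is affine in [q e]: it is [q e] if [e] is in [g], and
   [- q e + 1] otherwise. *)
transitivity (\prod_e ((if e \in g then 1 else -1) * q e + (e \notin g)%:R)).
  apply: eq_bigr => e _; case: ifP => _ /=; first by rewrite mul1r addr0.
  by rewrite mulN1r addrC.
rewrite bigA_distr; apply: eq_bigr => S _.
rewrite /moebius [X in _ = _ * X]big_mkcond -big_split /=.
by apply: eq_bigr => e _; case: ifP; rewrite ?mulr1.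
Qed.

Lemma ber_indicator g G : ber (fun e => (e \in G)%:R : R) g = (G == g)%:R.
Proof.
rewrite /ber; have [<-|Gg] := eqVneq G g.
  by rewrite big1 // => e _; case: (e \in G); rewrite ?subr0.
have /existsP[e eGg] : [exists e, (e \in G) != (e \in g)].
  rewrite -negb_forall; apply: contra Gg => /forallP h.
  by apply/eqP/setP => e; apply/eqP; exact: h.
rewrite (bigD1 e) //=; move: eGg; case: (e \in G); case: (e \in g) => // _;
  by rewrite ?subrr mul0r.
Qed.

Lemma prod_indicator S G : \prod_(e in S) ((e \in G)%:R : R) = (S \subset G)%:R.
Proof.
have [/fintype.subsetP SG|/fintype.subsetPn[e eS eG]] := boolP (S \subset G).
  by rewrite big1 // => e /SG ->.
by rewrite (bigD1 e) //= (negbTE eG) mul0r.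
Qed.

End InclusionExclusion.

Section InitialGraph.
Context {d : measure_display} {Omega : measurableType d} {R : realType}.
Variable P : probability Omega R.

Lemma bounded_integrable (f : Omega -> R) (M : R) (D : set Omega) :
  measurable D -> measurable_fun [set: Omega] f -> (forall w, `|f w| <= M) ->
  P.-integrable D (EFin \o f).
Proof.
move=> mD mf fM; apply: measurable_bounded_integrable => //.
- by rewrite (le_lt_trans (probability_le1 P mD)) // ltry.
- exact: measurable_funS mf.
by exists M; split; [rewrite num_real | move=> x Mx y _; exact: (le_trans (fM y) (ltW Mx))].
Qed.

Lemma integral_linear_combination (I : finType) (c : I -> R) (f : I -> Omega -> R)
    (D : set Omega) : measurable D ->
  (forall i, measurable_fun [set: Omega] (f i)) -> (forall i w, `|f i w| <= 1) ->
  (\int[P]_(w in D) (\sum_i c i * f i w)%:E =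
   \sum_i (c i)%:E * \int[P]_(w in D) (f i w)%:E)%E.
Proof.
move=> mD mf f1.
under eq_integral do rewrite -sumEFin.
rewrite integral_sum //.
  by apply: eq_bigr => i _; rewrite -(integralZl mD (bounded_integrable mD (mf i) (f1 i))).
move=> i; apply: (@bounded_integrable (fun w => c i * f i w) `|c i|) => //.
  exact: measurable_funM.
by move=> w; rewrite normrM ler_piMr.
Qed.

Lemma age_edge_prob_itv n (a : 'I_n -> R) e : (forall i, 0 <= a i) ->
  0 <= age_edge_prob a e <= 1.
Proof.
move=> a0; rewrite /age_edge_prob subr_ge0 lerBlDr lerDl expR_ge0 andbT.
by rewrite -expR0 ler_expR oppr_le0 divr_ge0 // le_min !a0.
Qed.

Lemma prod_age_edge_prob_itv n (a : 'I_n -> R) (S : {set edge n}) :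
  (forall i, 0 <= a i) -> 0 <= \prod_(e in S) age_edge_prob a e <= 1.
Proof.
move=> a0; apply/andP; split.
  by apply: prodr_ge0 => e _; case/andP: (age_edge_prob_itv e a0).
by apply: prodr_ile1 => e _; exact: age_edge_prob_itv.
Qed.

Lemma measurable_graph_event n (G : Omega -> graph n) (p : pred (graph n)) :
  (forall g, measurable [set w | G w = g]) -> measurable [set w | p (G w)].
Proof.
move=> mG; have -> : [set w | p (G w)] = \bigcup_(g in [set g | p g]) [set w | G w = g].
  by apply/seteqP; split=> w /= => [pG|[g pg ->]//]; exists (G w).
by apply: fin_bigcup_measurable => //; exact: finite_finset.
Qed.

(** Inclusion-exclusion recovers the conditional law of the whole graph from
    the product rule. *)
Lemma cond_graph_law n (F : set (set Omega)) (G : Omega -> graph n)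
    (a : 'I_n -> Omega -> R) (g : graph n) (H : set Omega) :
  (forall i w, 0 <= a i w) -> (forall g, measurable [set w | G w = g]) ->
  cond_age_graph P F G a -> F H ->
  (P ([set w | G w = g] `&` H) = \int[P]_(w in H) (ber (age_edge_prob (a ^~ w)) g)%:E)%E.
Proof.
move=> a0 mG cG FH.
have [FP _ _ _] := cG finset.set0; have mH := FP _ FH.
have mSG S := measurable_graph_event (fun g => S \subset g) mG.
have evE (S : {set edge n}) :
    \bigcap_(e in [set` S]) [set w | e \in G w] = [set w | S \subset G w].
  apply/seteqP; split=> w /= h; first by apply/fintype.subsetP => e; exact: h.
  by move=> e eS; exact: (fintype.subsetP h).
(* The law [ber] with the indicator of a graph as probabilities sits at that
   graph, so [ber_moebius] also expands the indicator of [G w = g]. *)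
transitivity (\int[P]_(w in H) (\sum_S moebius g S * \1_[set w | S \subset G w] w)%:E)%E.
  rewrite -integral_indic //; apply: eq_integral => w _; congr EFin.
  rewrite indicE (_ : (w \in _) = (G w == g)); last by
    apply/idP/eqP => [/set_mem//|?]; exact/mem_set.
  rewrite -ber_indicator ber_moebius; apply: eq_bigr => S _.
  rewrite prod_indicator indicE; congr (_ * _%:R); congr nat_of_bool.
  by apply/idP/idP => [?|/set_mem//]; exact/mem_set.
under [RHS]eq_integral do rewrite ber_moebius.
rewrite !integral_linear_combination //.
- apply: eq_bigr => S _; congr (_ * _)%E; rewrite integral_indic //.
  by have [_ _ _ hS] := cG S; rewrite -hS // evE.
- move=> S; have [_ _ mq _] := cG S; move=> _ B mB; rewrite setTI.
  by apply: FP; exact: mq.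
- by move=> S w; have /andP[p0 p1] := prod_age_edge_prob_itv S (a0 ^~ w); rewrite ger0_norm.
- by move=> S; exact: measurable_indic.
- by move=> S w; rewrite indicE; case: (_ \in _); rewrite ?normr0 ?normr1.
Qed.

End InitialGraph.

(** * Poisson points in the cells of the grid *)

Section PoissonCells.
Context {d : measure_display} {Omega : measurableType d} {R : realType}.
Variable P : probability Omega R.
Variables (M : finType) (rate : R) (Pi : Omega -> set (M * R)).
Hypothesis PPP : is_PPP P rate Pi.
Variable dt : R.
Hypothesis dt_ge0 : 0 <= dt.

Definition cell (m : M) (j : nat) : set (M * R) :=
  [set y | y.1 = m /\ j%:R * dt < y.2 <= j.+1%:R * dt].

Definition hit (w : Omega) (m : M) (j : nat) : bool :=
  `[< exists r, Pi w (m, r) /\ j%:R * dt < r <= j.+1%:R * dt >].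

Lemma xsection_cell m j m' : xsection (cell m j) m' =
  if m' == m then [set` `]j%:R * dt, j.+1%:R * dt]] else set0.
Proof.
apply/seteqP; split=> r; rewrite /xsection /=.
  by move=> /set_mem[/= -> rj]; rewrite eqxx /= in_itv.
by case: eqP => //= ->; rewrite in_itv /= => rj; exact/mem_set.
Qed.

Lemma measurable_cell m j : marked_measurable (cell m j).
Proof.
split=> [[m' r] [_ /= /andP[r0 _]]|m'].
  by rewrite (le_trans _ (ltW r0)) // mulr_ge0.
by rewrite xsection_cell; case: ifP => _ //; exact: measurable_itv.
Qed.

Lemma marked_mean_cell m j : marked_mean rate (cell m j) = (rate * dt)%:E.
Proof.
rewrite /marked_mean (bigD1 m) //= xsection_cell eqxx big1 => [|m' /negbTE m'm]; last first.
  by rewrite xsection_cell m'm measure0.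
rewrite adde0 lebesgue_measure_itv /= lte_fin.
have E : j.+1%:R * dt - j%:R * dt = dt by rewrite -addn1 natrD; ring.
case: ifP => h; first by rewrite -EFinD E -EFinM.
have : ~~ (0 < dt) by rewrite -E subr_gt0 h.
by rewrite -leNgt => dt0; rewrite (_ : dt = 0) ?mulr0 ?mule0 //; apply/eqP; rewrite eq_le dt0.
Qed.

Lemma point_count_eq0 (A : set (M * R)) w :
  point_count Pi A w = 0%E <-> Pi w `&` A = set0.
Proof.
rewrite /point_count /counting; split=> [|->]; last first.
  by rewrite asboolT ?fset_set0 //; exact: finite_set0.
case: asboolP => // fA [] /eqP; rewrite pnatr_eq0 cardfs_eq0 => /eqP h.
by rewrite -(fset_setK fA) h; apply/seteqP; split.
Qed.

Lemma hitN w m j : (point_count Pi (cell m j) w = 0%E) = (hit w m j = false).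
Proof.
apply/propext; rewrite point_count_eq0 /hit; split=> [h|/asboolPn h].
  apply/asboolPn => -[r [wr rj]].
  by have : (Pi w `&` cell m j) (m, r) by []; rewrite h.
apply/seteqP; split=> // -[m' r] [/= wr [/= mm rj]]; apply: h; exists r.
by rewrite -mm.
Qed.

Lemma probability_no_hit m j :
  P [set w | hit w m j = false] = (expR (- (rate * dt)))%:E.
Proof.
case: PPP => _ _ law _.
have mE := marked_mean_cell m j.
have := law _ (measurable_cell m j); rewrite mE ltry => /(_ isT 0%N).
rewrite /= expr0 mulr1 fact0 divr1 => <-.
by congr (P _); apply/seteqP; split=> w /=; rewrite hitN.
Qed.

Variable N : nat.

Definition hit_event (h : {set M * 'I_N}) : set Omega :=
  [set w | forall k : M * 'I_N, hit w k.1 k.2 = (k \in h)].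

Let B (h : {set M * 'I_N}) (k : M * 'I_N) : set (\bar R) :=
  if k \in h then ~` [set 0%E] else [set 0%E].

Lemma hit_event1 h (k : M * 'I_N) :
  point_count Pi (cell k.1 k.2) @^-1` B h k = [set w | hit w k.1 k.2 = (k \in h)].
Proof.
apply/seteqP; split=> w; rewrite /B /=; case: ifP => _ /=; rewrite hitN //.
- by case: (hit _ _ _).
- by case: (hit _ _ _).
Qed.

Lemma measurable_B h k : measurable (B h k).
Proof. by rewrite /B; case: ifP => _; [apply: measurableC|]; exact: emeasurable_set1. Qed.

Lemma sigma_points_hit_event h : sigma_points Pi (hit_event h).
Proof.
have -> : hit_event h = \bigcap_(k in [set: M * 'I_N])
    (point_count Pi (cell k.1 k.2) @^-1` B h k).
  apply/seteqP; split=> w /= hw k; last by have := hw k I; rewrite hit_event1.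
  by move=> _; rewrite hit_event1; exact: hw.
pose T := g_sigma_algebraType [set H | exists A, marked_measurable A /\
       exists2 B, measurable B & H = point_count Pi A @^-1` B].
suff : @measurable _ T (\bigcap_(k in [set: M * 'I_N])
    (point_count Pi (cell k.1 k.2) @^-1` B h k)) by [].
apply: fin_bigcap_measurable; first exact: finite_finset.
move=> k _; apply: sub_sigma_algebra; exists (cell k.1 k.2).
by split; [exact: measurable_cell | exists (B h k) => //; exact: measurable_B].
Qed.

Lemma trivIset_cell (k k' : M * 'I_N) :
  (cell k.1 k.2 `&` cell k'.1 k'.2) !=set0 -> k = k'.
Proof.
case: k k' => m j [m' j'] [[m1 r] /= [] [/= <- /andP[a1 a2]] [/= <- /andP[b1 b2]]].
congr (_, _); apply/eqP; apply: contraT => jj.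
have lt (i i' : nat) : (i < i')%N -> i.+1%:R * dt <= i'%:R * dt.
  by move=> ii; rewrite ler_wpM2r // ler_nat.
move: jj; rewrite -val_eqE neq_ltn => /orP[/lt h|/lt h] /=.
  by have := lt_le_trans b1 (le_trans a2 h); rewrite ltxx.
by have := lt_le_trans a1 (le_trans b2 h); rewrite ltxx.
Qed.

(** The counts in disjoint cells are independent, and a cell is missed when its
    count, a Poisson variable of mean [rate * dt], vanishes. *)
Lemma hit_law h :
  P (hit_event h) = (ber (fun=> 1 - expR (- (rate * dt))) h)%:E.
Proof.
case: PPP => _ _ _ indep.
(* Independence is given for families indexed by ordinals, so the cells are
   enumerated. *)
pose k_ (i : 'I_(#|{: M * 'I_N}|)) : M * 'I_N := enum_val i.
pose A i := cell (k_ i).1 (k_ i).2.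
have -> : hit_event h = \bigcap_i (point_count Pi (A i) @^-1` B h (k_ i)).
  apply/seteqP; split=> w /= hw.
    by move=> i _; rewrite hit_event1; exact: hw.
  move=> k; have := hw (enum_rank k) I; rewrite hit_event1 /k_ /=.
  by rewrite enum_rankK.
rewrite indep; first last.
- by move=> i; exact: measurable_B.
- move=> i j _ _ /trivIset_cell; rewrite /k_; exact: enum_val_inj.
- by move=> i; exact: measurable_cell.
transitivity (\prod_(k : (M * 'I_N)%type) P (point_count Pi (cell k.1 k.2) @^-1` B h k))%E.
  by rewrite [RHS](reindex _ (onW_bij _ (enum_val_bij (M * 'I_N)%type))).
rewrite /ber -prodEFin; apply: eq_bigr => k _; rewrite hit_event1.
have mm : measurable [set w | hit w k.1 k.2 = false].
  case: PPP => _ mc _ _; have := mc _ (measurable_cell k.1 k.2) measurableT _ (emeasurable_set1 0%E).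
  rewrite setTI; congr measurable.
  by apply/seteqP; split=> w /=; rewrite hitN.
case: ifP => _; last by rewrite opprB addrC subrK probability_no_hit.
have -> : [set w | hit w k.1 k.2 = true] = ~` [set w | hit w k.1 k.2 = false].
  by apply/seteqP; split=> w /=; case: (hit _ _ _).
by rewrite probability_setC // probability_no_hit.
Qed.

End PoissonCells.

(** * The exact law of the discretised process *)

Section Measurability.
Context {d : measure_display} {T : measurableType d} {R : realType}.

Lemma measurable_bool_real (b : T -> bool) :
  measurable_fun [set: T] b -> measurable_fun [set: T] (fun w => (b w)%:R : R).
Proof.
move=> mb; rewrite (_ : (fun w => _) = (fun w => if b w then 1 else 0 : R)).
  by apply: measurable_fun_ifT => //; exact: measurable_cst.
by apply/funext => w; case: (b w).
Qed.

Lemma measurable_all (I : Type) (s : seq I) (b : I -> T -> bool) :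
  (forall i, measurable_fun [set: T] (b i)) ->
  measurable_fun [set: T] (fun w => all (b ^~ w) s).
Proof.
move=> mb; elim: s => [|i s IH] /=; first exact: measurable_cst.
exact: measurable_and.
Qed.

Lemma measurable_age_edge_prob n (a : 'I_n -> T -> R) e :
  (forall i, measurable_fun [set: T] (a i)) ->
  measurable_fun [set: T] (fun w => age_edge_prob (a ^~ w) e).
Proof.
move=> ma; rewrite /age_edge_prob; apply: measurable_funB; first exact: measurable_cst.
apply: measurableT_comp => //; apply: measurableT_comp => //.
apply: measurable_funM; last exact: measurable_cst.
exact: measurable_minr.
Qed.

Lemma measurable_prod_age n (a : 'I_n -> T -> R) (S : {set edge n}) :
  (forall i, measurable_fun [set: T] (a i)) ->
  measurable_fun [set: T] (fun w => \prod_(e in S) age_edge_prob (a ^~ w) e).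
Proof.
move=> ma; under eq_fun do rewrite -big_enum /=.
by apply: measurable_prod => e _; exact: measurable_age_edge_prob.
Qed.

Lemma measurable_age n (a : 'I_n -> T -> R) (b : {ffun 'I_n -> option R}) s i :
  (forall i, measurable_fun [set: T] (a i)) ->
  measurable_fun [set: T] (fun w => age (a ^~ w) b s i).
Proof.
move=> ma; rewrite /age; case: (b i) => [r|]; first exact: measurable_cst.
by apply: measurable_funD => //; exact: measurable_cst.
Qed.

End Measurability.

Section GridLink.
Context {d : measure_display} {Omega : measurableType d} {R : realType}.
Variables (P : probability Omega R) (n : nat) (lambda : R).
Variables (E : Omega -> set (edge n * R)) (L : Omega -> set ('I_n * R)).
Variables (a0 : 'I_n -> Omega -> R) (G0 : Omega -> graph n).
Hypothesis data : mfffa_data P lambda E L a0 G0.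
Hypothesis cond0 : cond_age_graph P (sigma_ages a0) G0 a0.
Variables (dt : R) (N : nat).
Hypotheses (lambda_ge0 : 0 <= lambda) (dt_ge0 : 0 <= dt).
Local Notation mark := (@mark n).
Local Notation K := (mark * 'I_N)%type.

Definition hit_mark (w : Omega) (x : mark) (j : nat) : bool :=
  match x with inl e => hit E dt w e j | inr i => hit L dt w i j end.

Definition hits (w : Omega) : {set K} := [set k : K | hit_mark w k.1 k.2]%SET.

Definition hit_prob (x : mark) : R :=
  match x with
  | inl _ => 1 - expR (- (dt / n%:R))
  | inr _ => 1 - expR (- (lambda * dt))
  end.

Definition age_generators : set (set Omega) :=
  [set H | exists i, exists2 B, measurable B & H = a0 i @^-1` B].
Local Notation Ages := (g_sigma_algebraType age_generators).

Lemma a0_ge0 i w : 0 <= a0 i w.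
Proof. by case: data => _ _ /(_ i)[_]. Qed.

Lemma measurable_a0 i : measurable_fun [set: Omega] (a0 i).
Proof. by case: data => _ _ /(_ i)[]. Qed.

Lemma measurable_G0 g : measurable [set w | G0 w = g].
Proof. by case: data. Qed.

Lemma measurable_a0_Ages i : measurable_fun [set: Ages] (a0 i : Ages -> R).
Proof.
move=> _ B mB; rewrite setTI; apply: sub_sigma_algebra; exists i; exists B => //.
Qed.

Lemma sigma_ages_sub : <<s age_generators>> `<=` measurable.
Proof.
apply: smallest_sub => //; first exact: sigma_algebra_measurable.
by move=> _ [i [B mB ->]]; rewrite -[_ @^-1` _]setTI; exact: measurable_a0.
Qed.

Lemma ber_hit_prob (h : {set K}) :
  ber (hit_prob \o fst) h =
  ber (fun=> 1 - expR (- (n%:R^-1 * dt)))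
    [set k : edge n * 'I_N | (inl k.1, k.2) \in h]%SET *
  ber (fun=> 1 - expR (- (lambda * dt)))
    [set k : 'I_n * 'I_N | (inr k.1, k.2) \in h]%SET.
Proof.
pose F (x : mark) (j : 'I_N) : R :=
  if (x, j) \in h then hit_prob x else 1 - hit_prob x.
transitivity (\prod_(k : K) F k.1 k.2); first by apply: eq_bigr => -[].
rewrite -pair_bigA big_sumType /= !pair_bigA /ber /F /=.
congr (_ * _); apply: eq_bigr => k _; rewrite inE //.
by rewrite [n%:R^-1 * _]mulrC.
Qed.

Lemma hitsE h w : (hits w = h) =
  (hit_event E dt [set k : edge n * 'I_N | (inl k.1, k.2) \in h]%SET `&`
   hit_event L dt [set k : 'I_n * 'I_N | (inr k.1, k.2) \in h]%SET) w.
Proof.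
apply/propext; split=> [<-|[hE hL]].
  by split=> k; rewrite !inE.
apply/setP => -[[e|i] j]; rewrite inE /=.
  by rewrite (hE (e, j)) inE.
by rewrite (hL (i, j)) inE.
Qed.

Lemma measurable_ber_age g :
  measurable_fun [set: Omega] (fun w => ber (age_edge_prob (a0 ^~ w)) g).
Proof.
rewrite /ber; apply: measurable_prod => e _; case: (e \in g).
  exact: (measurable_age_edge_prob _ measurable_a0).
apply: measurable_funB; first exact: measurable_cst.
exact: (measurable_age_edge_prob _ measurable_a0).
Qed.

Lemma ber_age_ge0 w g : 0 <= ber (age_edge_prob (a0 ^~ w)) g.
Proof. by apply: ber_ge0 => e; apply: age_edge_prob_itv => i; exact: a0_ge0. Qed.

Lemma ber_hit_ge0 (h : {set K}) : 0 <= ber (hit_prob \o fst) h.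
Proof.
apply: ber_ge0 => -[[e|i] j] /=; rewrite subr_ge0 lerBlDr lerDl expR_ge0 andbT.
  by rewrite -expR0 ler_expR oppr_le0 divr_ge0.
by rewrite -expR0 ler_expR oppr_le0 mulr_ge0.
Qed.

(** The three sources of randomness decouple: the hits of the cells are
    independent of the initial data, and the initial graph is averaged out given
    the initial ages. *)
Lemma joint_law g h H : <<s age_generators>> H ->
  P (([set w | G0 w = g] `&` [set w | hits w = h]) `&` H) =
  (\int[P]_(w in H) (ber (age_edge_prob (a0 ^~ w)) g * ber (hit_prob \o fst) h)%:E)%E.
Proof.
move=> sH; have [PE PL _ _ indep] := data.
have -> : [set w | hits w = h] =
  hit_event E dt [set k : edge n * 'I_N | (inl k.1, k.2) \in h]%SET `&`
  hit_event L dt [set k : 'I_n * 'I_N | (inr k.1, k.2) \in h]%SET.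
  by apply/seteqP; split=> w /=; rewrite hitsE.
rewrite setIAC [X in P X]setIC indep; first last.
- pose T := g_sigma_algebraType [set H | (exists i, exists2 B, measurable B &
      H = a0 i @^-1` B) \/ exists g, H = [set w | G0 w = g]].
  suff : @measurable _ T ([set w | G0 w = g] `&` H) by [].
  apply: measurableI; first by apply: sub_sigma_algebra; right; exists g.
  apply: sH; split; first exact: sigma_algebra_measurable.
  by move=> A [i [B mB ->]]; apply: sub_sigma_algebra; left; exists i; exists B.
- exact: sigma_points_hit_event.
- exact: sigma_points_hit_event.
rewrite (cond_graph_law _ a0_ge0 measurable_G0 cond0 sH).
rewrite !(hit_law PE dt_ge0, hit_law PL dt_ge0) -EFinM -ber_hit_prob.
under [RHS]eq_integral do rewrite EFinM muleC.
have mH := sigma_ages_sub sH.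
rewrite ge0_integralZl_EFin //.
- by move=> w _; rewrite lee_fin ber_age_ge0.
- by apply/measurable_EFinP; apply: measurable_funTS; exact: measurable_ber_age.
- exact: ber_hit_ge0.
Qed.

Lemma sigma_points_measurable (M : finType) rate (Pi : Omega -> set (M * R)) :
  is_PPP P rate Pi -> sigma_points Pi `<=` measurable.
Proof.
case=> _ mc _ _; apply: smallest_sub => //; first exact: sigma_algebra_measurable.
by move=> _ [A [mA [B mB ->]]]; rewrite -[_ @^-1` _]setTI; exact: mc.
Qed.

Lemma measurable_hits h : measurable [set w | hits w = h].
Proof.
have [PE PL _ _ _] := data.
rewrite (_ : [set w | _] =
  hit_event E dt [set k : edge n * 'I_N | (inl k.1, k.2) \in h]%SET `&`
  hit_event L dt [set k : 'I_n * 'I_N | (inr k.1, k.2) \in h]%SET); last first.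
  by apply/seteqP; split=> w /=; rewrite hitsE.
apply: measurableI; [apply: (sigma_points_measurable PE)|
  apply: (sigma_points_measurable PL)]; exact: sigma_points_hit_event.
Qed.

(** The initial graph and the hits take finitely many values, each of which
    contributes through [joint_law] and [ge0_integral_cond]. What remains is, for
    fixed initial ages, the finite average treated by [grid_coins_law]. *)
Lemma expectation_link (F : graph n -> {set K} -> Omega -> R) :
  (forall g h, measurable_fun [set: Ages] (F g h : Ages -> R)) ->
  (forall g h w, 0 <= F g h w) ->
  (\int[P]_w (F (G0 w) (hits w) w)%:E =
   \int[P]_w (\sum_g ber (age_edge_prob (a0 ^~ w)) g *
     \sum_h ber (hit_prob \o fst) h * F g h w)%:E)%E.
Proof.
move=> mF F0.
pose A (p : graph n * {set K}) := [set w | G0 w = p.1] `&` [set w | hits w = p.2].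
pose k (p : graph n * {set K}) w :=
  ber (age_edge_prob (a0 ^~ w)) p.1 * ber (hit_prob \o fst) p.2.
have mA p : measurable (A p).
  by apply: measurableI; [exact: measurable_G0 | exact: measurable_hits].
have mk p : measurable_fun [set: Omega] (k p).
  by apply: measurable_funM; [exact: measurable_ber_age | exact: measurable_cst].
have k0 p w : 0 <= k p w by rewrite mulr_ge0 ?ber_age_ge0 ?ber_hit_ge0.
have mFO p : measurable_fun [set: Omega] (F p.1 p.2).
  exact: measurable_g_sigma sigma_ages_sub _.
transitivity (\sum_p \int[P]_w (F p.1 p.2 w * \1_(A p) w)%:E)%E.
  rewrite -ge0_integral_sum //; last 2 first.
  - move=> p; apply/measurable_EFinP; apply: measurable_funM.
      exact: mFO.
    exact: measurable_indic.
  - by move=> p w _; rewrite lee_fin mulr_ge0.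
  apply: eq_integral => w _; rewrite (bigD1 (G0 w, hits w)) //=.
  rewrite indicE mem_set ?mulr1 // big1 ?adde0 // => -[g h] gh.
  rewrite indicE memNset ?mulr0 // => -[/= eg eh].
  by move: gh; rewrite eg eh eqxx.
transitivity (\sum_p \int[P]_w (F p.1 p.2 w * k p w)%:E)%E.
  apply: eq_bigr => p _.
  apply: (ge0_integral_cond sigma_ages_sub) => // H sH; exact: joint_law.
rewrite -ge0_integral_sum //; last 2 first.
- by move=> p; apply/measurable_EFinP; apply: measurable_funM; [exact: mFO | exact: mk].
- by move=> p w _; rewrite lee_fin mulr_ge0.
apply: eq_integral => w _; rewrite sumEFin; congr EFin.
rewrite -(pair_bigA _ (fun g h => F g h w * k (g, h) w)) /=.
apply: eq_bigr => g _; rewrite big_distrr /=; apply: eq_bigr => h _.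
by rewrite /k /= mulrC mulrA.
Qed.

Definition cells : seq K := [seq (x, j) | j <- enum 'I_N, x <- enum {: mark}].

Lemma grid_cells : grid dt N = [seq (c.1, (val c.2).+1%:R * dt) | c <- cells].
Proof.
rewrite /grid -val_enum_ord /cells map_flatten; congr flatten.
rewrite -[LHS]map_comp -[RHS]map_comp; apply: eq_map => j /=.
by rewrite -[RHS]map_comp.
Qed.

Lemma uniq_cells : uniq cells.
Proof.
rewrite /cells allpairs_uniq ?enum_uniq // => -[j x] [j' x'] _ _ /= [-> ->] //.
Qed.

Definition hit_bits (h : {set K}) : seq bool := [seq c \in h | c <- cells].

(** The process at the end of the [k]th time cell, with every point moved to the
    end of its cell. *)
Definition level_state (k : nat) (w : Omega) : state :=
  grid_state dt k (hit_bits (hits w)) (G0 w).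

(** The events [past] only involve ages, which are functions of the initial ages
    and of the burning times; hence [grid_coins_law] applies for each value of
    the initial ages. *)
Lemma level_law (cs : seq (nat * R * 'I_n * R)) (S : {set edge n}) :
  let past w := all (fun c : nat * R * 'I_n * R => c.2 <
    age (a0 ^~ w) (level_state (minn c.1.1.1 N) w).2 c.1.1.2 c.1.2) cs in
  (\int[P]_w ((past w)%:R * (S \subset (level_state N w).1)%:R)%:E =
   \int[P]_w ((past w)%:R * \prod_(e in S)
     age_edge_prob (age (a0 ^~ w) (level_state N w).2 (N%:R * dt)) e)%:E)%E.
Proof.
move=> past.
pose Phi w (b : nat -> {ffun 'I_n -> option R}) : R :=
  (all (fun c : nat * R * 'I_n * R =>
     c.2 < age (a0 ^~ w) (b c.1.1.1) c.1.1.2 c.1.2) cs)%:R.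
have mPhi b : measurable_fun [set: Ages] (Phi ^~ b : Ages -> R).
  apply: (measurable_bool_real (T := Ages)).
  apply: (measurable_all (T := Ages)) => c; apply: measurable_fun_ltr.
    exact: measurable_cst.
  apply: measurable_age; exact: measurable_a0_Ages.
pose b (g : graph n) h k := (grid_state dt (minn k N) (hit_bits h) g).2.
pose F1 (g : graph n) h w := Phi w (b g h) * (S \subset (grid_state dt N (hit_bits h) g).1)%:R.
pose F2 (g : graph n) h w := Phi w (b g h) * \prod_(e in S)
  age_edge_prob (age (a0 ^~ w) (grid_state dt N (hit_bits h) g).2 (N%:R * dt)) e.
have age0 (g : graph n) h w :
    forall i, 0 <= age (a0 ^~ w) (grid_state dt N (hit_bits h) g).2 (N%:R * dt) i.
  apply: grid_age_ge0 => //; first by move=> i; exact: a0_ge0.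
  by rewrite grid_cells !size_map.
transitivity (\int[P]_w (F1 (G0 w) (hits w) w)%:E)%E; first by [].
transitivity (\int[P]_w (F2 (G0 w) (hits w) w)%:E)%E; last by [].
rewrite !expectation_link.
- apply: eq_integral => w _; congr EFin.
  have := grid_coins_law N (Phi w) S dt_ge0 (fun i => a0_ge0 i w)
    (fun e => erefl : hit_prob (inl e) = _).
  have -> : map fst (grid dt N) = map fst cells :> seq mark.
    by rewrite grid_cells -map_comp.
  under eq_bigr do rewrite coins_sum_ber ?uniq_cells //.
  by under [in RHS]eq_bigr do rewrite coins_sum_ber ?uniq_cells //.
- move=> g h; apply: measurable_funM => //.
  apply: (measurable_prod_age (T := Ages)
    (a := fun i w => age (a0 ^~ w) (grid_state dt N (hit_bits h) g).2 (N%:R * dt) i)).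
  by move=> i; apply: measurable_age; exact: measurable_a0_Ages.
- move=> g h w; rewrite mulr_ge0 //.
  by have /andP[] := prod_age_edge_prob_itv S (age0 g h w).
- by move=> g h; apply: measurable_funM => //; exact: measurable_cst.
- by move=> g h w; rewrite mulr_ge0.
Qed.

End GridLink.

(** * Fine grids see the points in the right order *)

Section Rounding.
Context {R : realType} {n : nat}.
Local Notation mark := (@mark n).

Lemma time_le_trans : transitive (@time_le R n).
Proof.
move=> [y r] [x s] [z u]; rewrite /time_le /=.
case/orP=> [sr|/andP[/eqP -> xy]] /orP[ru|/andP[/eqP <- yz]].
- by rewrite (lt_trans sr ru).
- by rewrite sr.
- by rewrite ru.
- by rewrite eqxx (leq_trans xy yz) orbT.
Qed.

Lemma time_le_total : total (@time_le R n).
Proof.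
move=> [x r] [y s]; rewrite /time_le /= eq_sym.
by case: ltgtP => //= _; exact: leq_total.
Qed.

(** The order in which the cells are processed: it mirrors [time_le], cells with
    the same time interval being ordered by their marks. *)
Definition cell_lt : rel (mark * nat) := fun c c' =>
  (c.2 < c'.2)%N || ((c.2 == c'.2) && (enum_rank c.1 < enum_rank c'.1)%N).

Lemma cell_lt_trans : transitive cell_lt.
Proof.
move=> [y r] [x s] [z u]; rewrite /cell_lt /=.
case/orP=> [sr|/andP[/eqP -> xy]] /orP[ru|/andP[/eqP <- yz]].
- by rewrite (ltn_trans sr ru).
- by rewrite sr.
- by rewrite ru.
- by rewrite eqxx (ltn_trans xy yz) orbT.
Qed.

Lemma cell_lt_irr : irreflexive cell_lt.
Proof. by move=> [x j]; rewrite /cell_lt /= ltnn eqxx ltnn. Qed.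

Definition index_grid (k : nat) : seq (mark * nat) :=
  flatten [seq [seq (x, j) | x <- enum {: mark}] | j <- iota 0 k].

Lemma index_gridS k : index_grid k.+1 = index_grid k ++ [seq (x, k) | x <- enum {: mark}].
Proof. by rewrite /index_grid -addn1 iotaD map_cat flatten_cat /= cats0. Qed.

Lemma mem_index_grid k c : (c \in index_grid k) = (c.2 < k)%N.
Proof.
elim: k => [|k IH]; first by rewrite ltn0.
rewrite index_gridS mem_cat IH ltnS [RHS]leq_eqVlt orbC; congr orb.
apply/mapP/eqP => [[x _ ->] //|ck]; exists c.1; first by rewrite mem_enum.
by rewrite -ck; case: c {IH ck}.
Qed.

Lemma sorted_index_grid k : sorted cell_lt (index_grid k).
Proof.
apply: pairwise_sorted; elim: k => [|k IH] //.
rewrite index_gridS pairwise_cat IH /=; apply/andP; split.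
  apply/allrelP => c c' ck /mapP[x _ ->].
  by rewrite /cell_lt /= -mem_index_grid ck.
rewrite pairwise_map; have := enum_uniq {: mark}.
rewrite -(sorted_pairwise (leT := relpre (fun x => (x, k)) cell_lt)); last first.
  by move=> x y z; exact: cell_lt_trans.
move=> _; suff : sorted (fun x y : mark => enum_rank x < enum_rank y)%N (enum {: mark}).
  by apply: sub_sorted => x y; rewrite /cell_lt /= eqxx => ->; rewrite orbT.
suff : sorted ltn (map (fun x : mark => val (enum_rank x)) (enum {: mark})).
  by rewrite sorted_map.
rewrite (_ : map _ _ = iota 0 #|{: mark}|) ?iota_ltn_sorted //.
apply: (@eq_from_nth _ 0%N); first by rewrite size_map size_iota -cardE.
move=> i; rewrite size_map -cardE => ic; rewrite nth_iota // add0n.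
pose o : 'I_(#|{: mark}|) := Ordinal ic.
by rewrite (nth_map (enum_val o)) -?cardE // -(enum_val_nth (enum_val o) o) enum_valK.
Qed.

Lemma count_below (p : pred nat) N j :
  (forall i j, (i <= j)%N -> p j -> p i) -> (j < N)%N ->
  (j < count p (iota 0 N))%N = p j.
Proof.
move=> mono; elim: N => // N IH jN.
rewrite -[in iota _ _](addn1 N) iotaD count_cat /= add0n addn0.
have [pN|pN] := boolP (p N).
  have -> : count p (iota 0 N) = N.
    rewrite -[RHS](size_iota 0); apply/eqP; rewrite -all_count.
    by apply/allP => i; rewrite mem_iota => /andP[_ /ltnW iN]; exact: mono pN.
  by rewrite addn1 jN; apply/esym; apply: mono pN.
rewrite addn0; move: jN; rewrite ltnS leq_eqVlt => /predU1P[->|]; last exact: IH.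
rewrite (negbTE pN) ltnNge -[X in (_ <= X)%N](size_iota 0) count_size //.
Qed.

Variables (d : R) (N : nat).
Hypothesis d_ge0 : 0 <= d.

(** The index of the first grid time that is at least [b] (or [N], if [b] exceeds
    all of them), which is also the number of cells that begin before [b]. *)
Definition round_index (b : R) : nat := count (fun j => j%:R * d < b) (iota 0 N).

Definition round_up (b : R) : R := (round_index b)%:R * d.

Lemma round_indexP b j : (j < N)%N -> (j < round_index b)%N = (j%:R * d < b).
Proof.
move=> jN; apply: count_below => // i k ik /(le_lt_trans _); apply.
by rewrite ler_wpM2r // ler_nat.
Qed.

Lemma round_index_le b : (round_index b <= N)%N.
Proof. by rewrite -[leqRHS](size_iota 0) count_size. Qed.

Lemma round_up_ge b : b <= N%:R * d -> b <= round_up b.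
Proof.
move=> bN; rewrite /round_up; have := round_index_le b.
rewrite leq_eqVlt => /predU1P[->//|lt].
by rewrite leNgt -round_indexP // ltnn.
Qed.

Lemma round_index_gt0 b : 0 < b -> b <= N%:R * d -> (0 < round_index b)%N.
Proof.
move=> b0 bN; have N0 : (0 < N)%N.
  by rewrite lt0n; apply: contraTneq bN => ->; rewrite mul0r -ltNge.
by rewrite round_indexP // mul0r.
Qed.

Lemma round_indexE b j : (j < N)%N -> j%:R * d < b -> b <= j.+1%:R * d ->
  round_index b = j.+1.
Proof.
move=> jN jb bj; apply/eqP; rewrite eqn_leq round_indexP // jb andbT.
move: (jN); rewrite leq_eqVlt => /predU1P[->|jN']; first exact: round_index_le.
by rewrite leqNgt round_indexP // -leNgt.
Qed.

Lemma round_up_lt b : 0 < b -> b <= N%:R * d -> round_up b < b + d.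
Proof.
move=> b0 bN; have := round_index_gt0 b0 bN.
rewrite /round_up; case E : (round_index b) => [//|j] _.
have jN : (j < N)%N by rewrite -E round_index_le.
by rewrite -addn1 natrD mulrDl mul1r ltrD2r -round_indexP // E.
Qed.

Lemma round_index_lt b b' : 0 < b -> 0 < b' -> b' <= N%:R * d -> b + d <= b' ->
  (round_index b < round_index b')%N.
Proof.
move=> b0 b'0 b'N bb'; have bN : b <= N%:R * d.
  by rewrite (le_trans _ b'N) // (le_trans _ bb') // lerDl.
have := lt_le_trans (round_up_lt b0 bN) (le_trans bb' (round_up_ge b'N)).
rewrite ltNge; apply: contraNltn => h.
by rewrite ler_wpM2r // ler_nat.
Qed.

End Rounding.

Section LevelPoints.
Context {d : measure_display} {Omega : measurableType d} {R : realType} {n : nat}.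
Variables (E : Omega -> set (edge n * R)) (L : Omega -> set ('I_n * R)).
Local Notation mark := (@mark n).

Definition mark_points w : set (mark * R) :=
  [set (inl x.1, x.2) | x in E w] `|` [set (inr x.1, x.2) | x in L w].

Lemma hit_markP dt w x j : reflect
  (exists r, mark_points w (x, r) /\ j%:R * dt < r <= j.+1%:R * dt)
  (hit_mark E L dt w x j).
Proof.
case: x => [e|i]; rewrite /hit_mark /hit; apply: (iffP (asboolP _)).
- by move=> [r [er rj]]; exists r; split=> //; left; exists (e, r).
- by move=> [r [[[[e' r'] /= h [<- <-]]|[? _ //]] rj]]; exists r'.
- by move=> [r [er rj]]; exists r; split=> //; right; exists (i, r).
- by move=> [r [[[? _ //]|[[i' r'] /= h [<- <-]]] rj]]; exists r'.
Qed.

Lemma grid_index_grid dt k :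
  grid dt k = [seq (c.1, c.2.+1%:R * dt) | c <- index_grid k] :> seq (mark * R).
Proof.
rewrite /grid /index_grid map_flatten -[in RHS]map_comp; congr flatten.
by apply: eq_map => j /=; rewrite -[RHS]map_comp.
Qed.

Lemma level_mask dt N k w : (k <= N)%N ->
  mask (hit_bits (hits E L dt N w)) (grid dt k) =
  [seq (c.1, c.2.+1%:R * dt) | c <- index_grid k & hit_mark E L dt w c.1 c.2].
Proof.
move=> kN; have -> : hit_bits (hits E L dt N w) =
    [seq hit_mark E L dt w c.1 c.2 | c <- index_grid N].
  have -> : index_grid N = [seq (c.1, val c.2) | c <- cells n N].
    rewrite /index_grid -val_enum_ord /cells map_flatten; congr flatten.
    rewrite -[LHS]map_comp -[RHS]map_comp; apply: eq_map => j /=.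
    by rewrite -[RHS]map_comp.
  by rewrite /hit_bits -map_comp; apply: eq_map => c; rewrite inE.
have [rest ->] : exists rest, index_grid N = index_grid k ++ rest :> seq (mark * nat).
  exists (flatten [seq [seq (x, j) | x <- enum {: mark}] | j <- iota k (N - k)]).
  by rewrite -[in LHS](subnKC kN) /index_grid iotaD map_cat flatten_cat.
rewrite map_cat -[grid dt k]cats0 mask_cat ?mask0 ?cats0; last first.
  by rewrite grid_index_grid !size_map.
by rewrite grid_index_grid -map_mask -filter_mask.
Qed.

(** Distinct times fall in distinct cells, and equal times are ordered by their
    marks on both sides. So both lists are strictly increasing for [cell_lt], and
    it is enough that they have the same elements. *)
Lemma hit_cells_sort (dt s t : R) N k w :
  0 <= dt -> t = N%:R * dt -> s <= t -> (k <= N)%N ->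
  finite_set (points_upto E L t w) ->
  (forall p p', points_upto E L t w p -> points_upto E L t w p' ->
     p.2 < p'.2 -> p.2 + dt <= p'.2) ->
  (forall p, points_upto E L t w p ->
     (p.2 <= s) = (round_index dt N p.2 <= k)%N) ->
  [seq c <- index_grid k | hit_mark E L dt w c.1 c.2] =
  [seq (p.1, (round_index dt N p.2).-1) |
     p <- sort time_le (fset_set (points_upto E L s w))].
Proof.
move=> dt0 tE st kN fin sep hk.
have sub : points_upto E L s w `<=` points_upto E L t w.
  by move=> p [pw /andP[p0 ps]]; split=> //=; rewrite p0 (le_trans ps st).
have fins := sub_finite_set sub fin.
have mems p : (p \in sort time_le (fset_set (points_upto E L s w))) <->
    points_upto E L s w p.
  rewrite mem_sort in_fset_set //; split=> [/set_mem//|]; exact: mem_set.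
have pos p : points_upto E L t w p -> 0 < p.2 /\ p.2 <= N%:R * dt.
  by case=> _ /andP[? ?]; rewrite -tE.
apply: (irr_sorted_eq cell_lt_trans cell_lt_irr).
- rewrite (sorted_pairwise cell_lt_trans); apply: pairwise_filter.
  by rewrite -(sorted_pairwise cell_lt_trans) sorted_index_grid.
- apply: pairwise_sorted; rewrite pairwise_map.
  have := sort_sorted (@time_le_total R n) (fset_set (points_upto E L s w)).
  rewrite (sorted_pairwise (@time_le_trans R n)) => sle.
  have := fset_uniq (fset_set (points_upto E L s w)).
  rewrite -(sort_uniq time_le) uniq_pairwise => suniq.
  have := conj sle suniq => /andP; rewrite -pairwise_relI.
  apply: (@sub_in_pairwise _ (mem (sort time_le (fset_set (points_upto E L s w))))).
    move=> p p' /mems/sub tp /mems/sub tp' /= /andP[le ne]; rewrite /cell_lt /=.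
    have [p0 pN] := pos _ tp; have [p'0 p'N] := pos _ tp'.
    have ip := round_index_gt0 dt0 p0 pN; have ip' := round_index_gt0 dt0 p'0 p'N.
    case/orP: le => [lt|/andP[/eqP eq le]].
      have := round_index_lt dt0 p0 p'0 p'N (sep _ _ tp tp' lt).
      by rewrite -(prednK ip) -(prednK ip') ltnS => ->.
    apply/orP; right; rewrite eq eqxx /= ltn_neqAle; apply/andP; split; last exact: le.
    apply: contra ne => /eqP/val_inj/enum_rank_inj e.
    by rewrite (surjective_pairing p) (surjective_pairing p') e eq.
  by apply/allP.
- move=> [x j]; rewrite mem_filter mem_index_grid /=; apply/andP/mapP.
    move=> [/hit_markP[b [wb /andP[jb bj]]] jk].
    have jN := leq_trans jk kN.
    have tb : points_upto E L t w (x, b).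
      split=> //=; rewrite (le_lt_trans _ jb) ?mulr_ge0 //= tE (le_trans bj) //.
      by rewrite ler_wpM2r // ler_nat.
    exists (x, b) => /=; last by rewrite (round_indexE dt0 jN).
    apply/mems; split=> //=; rewrite (hk (x, b)) //= (round_indexE dt0 jN) // jk andbT.
    by case/pos: tb.
  move=> [[y b] /mems sb [-> ->]] /=; have tb := sub _ sb.
  have [/= b0 bN] := pos _ tb; have ib := round_index_gt0 dt0 b0 bN.
  have := sb.2 => /andP[_ /=]; rewrite (hk _ tb) /= => ik.
  rewrite (prednK ib) ik; split=> //; apply/hit_markP; exists b; split; first by case: tb.
  have jN : ((round_index dt N b).-1 < N)%N by rewrite (prednK ib) (leq_trans ik kN).
  by rewrite -(round_indexP dt0 b jN) !(prednK ib) leqnn (round_up_ge dt0 bN).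
Qed.

End LevelPoints.

Section LevelLimit.
Context {d : measure_display} {Omega : measurableType d} {R : realType} {n : nat}.
Variables (E : Omega -> set (edge n * R)) (L : Omega -> set ('I_n * R)).
Variables (G0 : Omega -> graph n) (a0 : 'I_n -> Omega -> R).
Local Notation mark := (@mark n).
Local Notation burns := {ffun 'I_n -> option R}.

(** The dates of the points only enter the burning times, never the graph. *)
Lemma foldl_step_redate (f : R -> R) g (b : burns) (l : seq (mark * R)) :
  foldl step (g, [ffun i => omap f (b i)]) [seq (p.1, f p.2) | p <- l] =
  ((foldl step (g, b) l).1, [ffun i => omap f ((foldl step (g, b) l).2 i)]).
Proof.
elim: l g b => [|[[e|i] r] l IH] g b //=; first exact: IH.
rewrite {2 3}/step /= -IH /step /=; congr foldl; congr (_, _).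
by apply/ffunP => j; rewrite !ffunE; case: ifP.
Qed.

Lemma last_burn_mem g (l : seq (mark * R)) i r :
  (foldl step (g, [ffun=> None]) l).2 i = Some r -> exists2 p, p \in l & p.2 = r.
Proof.
elim/last_ind: l r => [|l [x u] IH] r /=; first by rewrite ffunE.
rewrite foldl_rcons.
have old : (foldl step (g, [ffun=> None]) l).2 i = Some r ->
    exists2 p, p \in rcons l (x, u) & p.2 = r.
  by move=> /IH[p pl pr]; exists p => //; rewrite mem_rcons inE pl orbT.
case: x old => [e|j] old //=; rewrite ffunE; case: ifP => // _ [<-].
by exists (inr j, u) => //; rewrite mem_rcons mem_head.
Qed.

Lemma level_state_round (dt s t : R) N k w :
  0 <= dt -> t = N%:R * dt -> s <= t -> (k <= N)%N ->
  finite_set (points_upto E L t w) ->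
  (forall p p', points_upto E L t w p -> points_upto E L t w p' ->
     p.2 < p'.2 -> p.2 + dt <= p'.2) ->
  (forall p, points_upto E L t w p ->
     (p.2 <= s) = (round_index dt N p.2 <= k)%N) ->
  level_state E L G0 dt N k w =
  ((mfff_state E L G0 s w).1,
   [ffun i => omap (round_up dt N) ((mfff_state E L G0 s w).2 i)]).
Proof.
move=> dt0 tE st kN fin sep hk.
rewrite /level_state /grid_state level_mask // (hit_cells_sort dt0 tE st kN fin sep hk).
rewrite -map_comp /mfff_state -foldl_step_redate; congr foldl.
  by congr (_, _); apply/ffunP => i; rewrite !ffunE.
have sub : points_upto E L s w `<=` points_upto E L t w.
  by move=> p [pw /andP[p0 ps]]; split=> //=; rewrite p0 (le_trans ps st).
apply/eq_in_map => p; rewrite mem_sort in_fset_set; last exact: sub_finite_set fin.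
move=> /set_mem/sub[_ /andP[p0 pt]] /=; congr (_, _); rewrite /round_up prednK //.
by apply: round_index_gt0; rewrite -?tE.
Qed.

(** Finitely many reals have a positive minimal gap, which any fine enough mesh
    beats. *)
Lemma seq_gap (l : seq R) : exists2 e : R, 0 < e &
  forall x y, x \in l -> y \in l -> x < y -> x + e <= y.
Proof.
elim: l => [|z l [e e0 IH]]; first by exists 1.
have [e' e'0 He'] : exists2 e', 0 < e' &
    forall y, y \in l -> (z < y -> z + e' <= y) /\ (y < z -> y + e' <= z).
  elim: (l) => [|y l' [e' e'0 He']]; first by exists 1.
  have [->|zy] := eqVneq y z.
    by exists e' => // u; rewrite inE => /predU1P[->|/He' //]; rewrite ltxx.
  exists (Num.min e' `|y - z|); first by rewrite lt_min e'0 normr_gt0 subr_eq0.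
  move=> u; rewrite inE => /predU1P[->|/He'[h1 h2]]; split=> lt.
  - rewrite -lerBrDl ge_min; apply/orP; right.
    by rewrite ger0_norm // subr_ge0 ltW.
  - rewrite -lerBrDl ge_min; apply/orP; right.
    by rewrite distrC ger0_norm // subr_ge0 ltW.
  - by rewrite (le_trans _ (h1 lt)) // lerD2l ge_min lexx.
  - by rewrite (le_trans _ (h2 lt)) // lerD2l ge_min lexx.
exists (Num.min e e'); first by rewrite lt_min e0 e'0.
move=> x y; rewrite !inE => /predU1P[->|xl] /predU1P[->|yl] lt.
- by rewrite ltxx in lt.
- by rewrite (le_trans _ ((He' _ yl).1 lt)) // lerD2l ge_min lexx orbT.
- by rewrite (le_trans _ ((He' _ xl).2 lt)) // lerD2l ge_min lexx orbT.
- by rewrite (le_trans _ (IH _ _ xl yl lt)) // lerD2l ge_min lexx.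
Qed.

Definition mesh (t : R) (N : nat) : R := t / N.+1%:R.

Lemma mesh_ge0 t N : 0 <= t -> 0 <= mesh t N.
Proof. by move=> t0; rewrite divr_ge0. Qed.

Lemma meshE t N : t = N.+1%:R * mesh t N.
Proof. by rewrite /mesh mulrC divfK. Qed.

Lemma mesh_small t (e : R) : 0 < e -> \forall N \near \oo, mesh t N <= e.
Proof.
move=> e0; have c : mesh t N @[N --> \oo] --> 0.
  rewrite -[X in _ --> X](mulr0 t); apply: cvgMr; exact: cvg_harmonic.
by near do apply: ltW; apply: (cvgr_lt 0).
Unshelve. all: by end_near. Qed.

(** The state at time [s] is read after the cells that begin before [s]. At
    [s = t] all cells are run, which also covers [t = 0], where every cell is
    empty and none begins before [t]. *)
Definition level (t : R) (N : nat) (s : R) (w : Omega) : state :=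
  level_state E L G0 (mesh t N) N.+1
    (if s < t then round_index (mesh t N) N.+1 s else N.+1) w.

(** It suffices that the mesh be below the minimal gap of the times of the
    points, together with [s] itself: then no point after [s] lies in a cell
    that begins before [s]. *)
Lemma level_near (t s : R) w : 0 <= s -> s <= t ->
  finite_set (points_upto E L t w) ->
  \forall N \near \oo, level t N s w = ((mfff_state E L G0 s w).1,
    [ffun i => omap (round_up (mesh t N) N.+1) ((mfff_state E L G0 s w).2 i)]).
Proof.
move=> s0 st fin; have t0 := le_trans s0 st.
(* The time [s] takes part in the gaps, so that a later point does not share
   its cell. *)
pose l := s :: [seq p.2 | p <- fset_set (points_upto E L t w)].
have [e e0 He] := seq_gap l.
have inl p : points_upto E L t w p -> p.2 \in l.
  move=> tp; rewrite inE; apply/orP; right; apply/mapP; exists p => //.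
  by rewrite in_fset_set //; exact: mem_set.
near=> N; have me : mesh t N <= e by near: N; exact: mesh_small.
have m0 := mesh_ge0 N t0; have tE := meshE t N.
have sep x y : x \in l -> y \in l -> x < y -> x + mesh t N <= y.
  by move=> xl yl xy; rewrite (le_trans _ (He _ _ xl yl xy)) // lerD2l.
apply: (level_state_round m0 tE st) => //.
- by case: ifP => // _; exact: round_index_le.
- by move=> p p' /inl pl /inl pl'; exact: sep.
move=> p tp; have [_ /= /andP[p0 pt]] := tp.
case: (ltP s t) => [lt|ts]; last first.
  by rewrite (le_trans pt ts) round_index_le.
have [ps|sp] := leP p.2 s.
  apply/esym; apply: sub_count => j /= /lt_le_trans; exact.
apply/esym/negbTE; rewrite -ltnNge.
have [s1|s1] := ltP 0 s.
  apply: round_index_lt => //; rewrite -?tE //; apply: sep => //.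
    by rewrite inE eqxx.
  exact: inl.
(* At [s = 0] no cell begins before [s]. *)
rewrite (_ : round_index _ _ s = 0%N); first by apply: round_index_gt0; rewrite -?tE.
apply/eqP; rewrite -leqn0 leqNgt round_indexP // mul0r -leNgt //.
Unshelve. all: by end_near. Qed.

Definition level_age (t : R) (N : nat) (s : R) (i : 'I_n) (w : Omega) : R :=
  age (a0 ^~ w) (level t N s w).2 s i.

Lemma mfffa_ageE s i w :
  mfffa_age E L G0 a0 s i w = age (a0 ^~ w) (mfff_state E L G0 s w).2 s i.
Proof. by []. Qed.

Lemma round_burn (t s : R) w i r N : 0 <= t -> s <= t ->
  (mfff_state E L G0 s w).2 i = Some r ->
  finite_set (points_upto E L s w) ->
  r <= round_up (mesh t N) N.+1 r < r + mesh t N.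
Proof.
move=> t0 st; rewrite /mfff_state => /last_burn_mem[p ps pr] fin.
move: ps; rewrite mem_sort in_fset_set // => /set_mem[_ /=]; rewrite pr => /andP[r0 rs].
have rt : r <= N.+1%:R * mesh t N by rewrite -meshE (le_trans rs st).
by rewrite round_up_ge ?round_up_lt // mesh_ge0.
Qed.

Lemma points_upto_sub s t w : s <= t ->
  points_upto E L s w `<=` points_upto E L t w.
Proof.
by move=> st p [pw /andP[p0 ps]]; split=> //=; rewrite p0 (le_trans ps st).
Qed.

Lemma level_age_near (t s : R) i w : 0 <= s -> s <= t ->
  finite_set (points_upto E L t w) ->
  \forall N \near \oo, level_age t N s i w =
    if (mfff_state E L G0 s w).2 i is Some r
    then s - round_up (mesh t N) N.+1 r else a0 i w + s.
Proof.
move=> s0 st fin; apply: filterS (level_near s0 st fin) => N lE.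
by rewrite /level_age /age lE /= ffunE; case: (_ i).
Qed.

(** Dating the burnings late makes the ages smaller, so that strict lower
    bounds on the ages are eventually decided as in the limit. *)
Lemma level_age_gt_near (t s x : R) i w : 0 <= s -> s <= t ->
  finite_set (points_upto E L t w) ->
  \forall N \near \oo, (x < level_age t N s i w) = (x < mfffa_age E L G0 a0 s i w).
Proof.
move=> s0 st fin; have near1 := level_age_near i s0 st fin.
have fins := sub_finite_set (points_upto_sub st) fin.
rewrite mfffa_ageE /age; move: near1.
case Eb : ((mfff_state E L G0 s w).2 i) => [r|] near1; last first.
  by apply: filterS near1 => N ->.
have up N := round_burn N (le_trans s0 st) st Eb fins.
have [xr|xr] := ltP x (s - r); near=> N.
  have -> : level_age t N s i w = s - round_up (mesh t N) N.+1 r.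
    by near: N; exact: near1.
  (* A delay of at most [s - r - x] does not make the age cross the bound. *)
  have me : mesh t N <= s - r - x by near: N; apply: mesh_small; rewrite subr_gt0.
  by have /andP[_ up2] := up N; apply/idP; lra.
have -> : level_age t N s i w = s - round_up (mesh t N) N.+1 r.
  by near: N; exact: near1.
by have /andP[up1 _] := up N; apply/negbTE; rewrite -leNgt; lra.
Unshelve. all: by end_near. Qed.

Lemma level_age_cvg (t s : R) i w : 0 <= s -> s <= t ->
  finite_set (points_upto E L t w) ->
  level_age t N s i w @[N --> \oo] --> mfffa_age E L G0 a0 s i w.
Proof.
move=> s0 st fin; have near1 := level_age_near i s0 st fin.
have fins := sub_finite_set (points_upto_sub st) fin.
rewrite mfffa_ageE /age; move: near1.
case Eb : ((mfff_state E L G0 s w).2 i) => [r|] near1; last first.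
  by apply: cvg_near_cst; apply: filterS near1 => N ->.
apply/cvgrPdist_le => e e0; near=> N.
have me : mesh t N <= e by near: N; exact: mesh_small.
have -> : level_age t N s i w = s - round_up (mesh t N) N.+1 r.
  by near: N; exact: near1.
have /andP[up1 up2] := round_burn N (le_trans s0 st) st Eb fins.
by rewrite ger0_norm; lra.
Unshelve. all: by end_near. Qed.

End LevelLimit.

(** * Measurability and almost sure finiteness *)

Section Finiteness.
Context {d : measure_display} {Omega : measurableType d} {R : realType}.
Variable P : probability Omega R.

(** This is the exponential series. It is what excludes infinitely many points,
    since the counts are only specified through their finite values. *)
Lemma poisson_total (m : R) : 0 <= m ->
  (\sum_(k <oo) (expR (- m) * m ^+ k / k`!%:R)%:E = 1)%E.
Proof.
move=> m0.
transitivity ((expR (- m))%:E * \sum_(k <oo) (m ^+ k / k`!%:R)%:E)%E.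
  rewrite -nneseriesZl /=; last by move=> k _; rewrite lee_fin divr_ge0 // exprn_ge0.
  by apply: eq_eseriesr => k _; rewrite -EFinM mulrA.
rewrite (_ : (\sum_(k <oo) _)%E = (expR m)%:E).
  by rewrite -EFinM expRN mulVf // gt_eqF ?expR_gt0.
rewrite expRE -EFin_lim; last first.
  rewrite /pseries /=; under eq_fun do rewrite mulrC.
  exact: is_cvg_series_exp_coeff.
apply/congr_lim/funext => k /=; rewrite /pseries /series /= -sumEFin //.
by under [RHS]eq_bigr do rewrite mulrC.
Qed.

Lemma point_count_natE (M : finType) (Pi : Omega -> set (M * R)) A w :
  finite_set (Pi w `&` A) <-> exists k : nat, point_count Pi A w = k%:R%:E.
Proof.
rewrite /point_count /counting; split=> [fA|[k]].
  by rewrite asboolT //; eexists.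
by case: asboolP.
Qed.

Lemma marked_measurable_upto (M : finType) (t : R) :
  marked_measurable ([set x | 0 < x.2 <= t] : set (M * R)).
Proof.
split=> [x /= /andP[/ltW]//|m].
rewrite (_ : xsection _ _ = [set` `]0, t]]); first exact: measurable_itv.
apply/seteqP; split=> r; rewrite /xsection /= in_itv /=; first by move=> /set_mem.
by move=> h; exact/mem_set.
Qed.

Lemma measurable_finite_points (M : finType) rate (Pi : Omega -> set (M * R)) t :
  is_PPP P rate Pi -> measurable [set w | finite_set (Pi w `&` [set x | 0 < x.2 <= t])].
Proof.
case=> _ mc _ _; have mA := marked_measurable_upto M t.
rewrite (_ : [set w | _] = \bigcup_k
   (point_count Pi [set x | 0 < x.2 <= t] @^-1` [set (k : nat)%:R%:E])); last first.
  apply/seteqP; split=> w /=; rewrite point_count_natE; first by case=> k; exists k.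
  by case=> k _ /=; exists k.
apply: bigcup_measurable => k _; rewrite -[X in measurable X]setTI.
by apply: mc => //; exact: emeasurable_set1.
Qed.

Lemma ae_finite_points (M : finType) rate (Pi : Omega -> set (M * R)) (t : R) :
  0 <= rate -> 0 <= t -> is_PPP P rate Pi ->
  P [set w | finite_set (Pi w `&` [set x | 0 < x.2 <= t])] = 1%E.
Proof.
move=> r0 t0 PPP; have [_ mc law _] := PPP; have mA := marked_measurable_upto M t.
pose A : set (M * R) := [set x | 0 < x.2 <= t].
rewrite (_ : [set w | _] = \bigcup_k [set w | point_count Pi A w = (k : nat)%:R%:E]);
  last first.
  apply/seteqP; split=> w /=; rewrite point_count_natE; first by case=> k; exists k.
  by case=> k _ /=; exists k.
have mean : marked_mean rate A = (rate * (\sum_(m : M) t))%:E.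
  rewrite /marked_mean EFinM; congr (_ * _)%E; rewrite -sumEFin.
  apply: eq_bigr => m _; rewrite (_ : xsection _ _ = [set` `]0, t]]).
    by rewrite lebesgue_measure_itv /= lte_fin sube0; case: ltP => // ?;
      congr EFin; apply/eqP; rewrite eq_le t0.
  apply/seteqP; split=> r; rewrite /xsection /= in_itv /=; first by move=> /set_mem.
  by move=> h; exact/mem_set.
rewrite measure_bigcup; last 2 first.
- move=> k _; rewrite -[X in measurable X]setTI.
  by apply: (mc A mA measurableT [set k%:R%:E]); exact: emeasurable_set1.
- by move=> i j _ _ [w [/= -> []]] /eqP; rewrite eqr_nat => /eqP.
rewrite -(poisson_total (m := rate * \sum_(m : M) t)); last first.
  by rewrite mulr_ge0 // sumr_ge0.
rewrite eseries_mkcond; apply: eq_eseriesr => k _; rewrite in_setT.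
by have := law A mA; rewrite mean ltry => /(_ isT k).
Qed.

Variables (n : nat) (lambda : R).
Variables (E : Omega -> set (edge n * R)) (L : Omega -> set ('I_n * R)).
Variables (a0 : 'I_n -> Omega -> R) (G0 : Omega -> graph n).
Hypothesis data : mfffa_data P lambda E L a0 G0.
Hypothesis lambda_ge0 : 0 <= lambda.

Definition tame (t : R) : set Omega := [set w | finite_set (points_upto E L t w)].

Lemma tameE t : tame t =
  [set w | finite_set (E w `&` [set x | 0 < x.2 <= t])] `&`
  [set w | finite_set (L w `&` [set x | 0 < x.2 <= t])].
Proof.
have upE w : points_upto E L t w =
    [set (inl x.1, x.2) | x in E w `&` [set x | 0 < x.2 <= t]] `|`
    [set (inr x.1, x.2) | x in L w `&` [set x | 0 < x.2 <= t]].
  apply/seteqP; split=> [p [[|] [x xw <-] h]|p [|] [x [xw h] <-]].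
  - by left; exists x.
  - by right; exists x.
  - by split=> //; left; exists x.
  - by split=> //; right; exists x.
have fin_inj (T1 T2 : choiceType) (f : T1 -> T2) (B : set T1) : injective f ->
    finite_set (f @` B) -> finite_set B.
  move=> fi; suff -> : finite_set (f @` B) = finite_set B by [].
  by apply: eq_finite_set; apply: inj_card_eq => x y _ _; exact: fi.
apply/seteqP; split=> w; rewrite /tame /= upE finite_setU; last first.
  by case=> h1 h2; split; apply: finite_image.
case=> h1 h2; split.
  by apply: fin_inj h1 => -[e r] [e' r'] [-> ->].
by apply: fin_inj h2 => -[e r] [e' r'] [-> ->].
Qed.

Lemma measurable_tame t : measurable (tame t).
Proof.
have [PE PL _ _ _] := data; rewrite tameE.
by apply: measurableI; [exact: measurable_finite_points PE | exact: measurable_finite_points PL].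
Qed.

Lemma ae_tame t : 0 <= t -> P (~` tame t) = 0%E.
Proof.
move=> t0; have [PE PL _ _ _] := data.
have mE := measurable_finite_points t PE; have mL := measurable_finite_points t PL.
have rE : 0 <= (n%:R^-1 : R) by rewrite invr_ge0.
have E1 := ae_finite_points rE t0 PE; have L1 := ae_finite_points lambda_ge0 t0 PL.
have cE : (P (~` [set w | finite_set (E w `&` [set x | (0 < x.2 <= t)%R])]) <= 0)%E.
  by rewrite probability_setC // E1 subee.
have cL : (P (~` [set w | finite_set (L w `&` [set x | (0 < x.2 <= t)%R])]) <= 0)%E.
  by rewrite probability_setC // L1 subee.
apply/eqP; rewrite tameE setCI -measure_le0.
apply: le_trans (measureU2 _ (measurableC mE) (measurableC mL)) _.
by rewrite -[leRHS]adde0; apply: leeD.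
Qed.

(** A grid approximation is a function of finitely many events. *)
Lemma measurable_level_state dt N k (F : @state R n -> R) : 0 <= dt ->
  measurable_fun [set: Omega] (fun w => F (level_state E L G0 dt N k w)).
Proof.
move=> dt0.
pose A (p : graph n * {set (mark * 'I_N)%type}) :=
  [set w | G0 w = p.1] `&` [set w | hits E L dt N w = p.2].
rewrite (_ : (fun w => _) = (fun w => \sum_p
    F (grid_state dt k (hit_bits p.2) p.1) * \1_(A p) w)); last first.
  apply/funext => w; rewrite (bigD1 (G0 w, hits E L dt N w)) //=.
  rewrite indicE mem_set // mulr1 big1 ?addr0 // => -[g h] gh.
  by rewrite indicE memNset ?mulr0 // => -[/= eg eh]; rewrite eg eh eqxx in gh.
apply: measurable_sum => p; apply: measurable_funM; first exact: measurable_cst.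
apply: measurable_indic; apply: measurableI.
  exact: (measurable_G0 data).
exact: (measurable_hits data).
Qed.

(** An infinite set has the empty list as its enumeration. *)
Lemma mfff_state_wild t w : ~ tame t w -> mfff_state E L G0 t w = (G0 w, [ffun=> None]).
Proof.
move=> nt; rewrite /mfff_state (_ : fset_set _ = fset0) ?/sort //.
by rewrite /fset_set; case: pselect.
Qed.

(** Measurability has to hold everywhere, not just almost surely, so the wild
    configurations, where the approximations need not converge, are patched. *)
Lemma measurable_of_levels t (f : Omega -> R) (f0 : Omega -> R) (fN : nat -> Omega -> R) :
  measurable_fun [set: Omega] f0 -> (forall N, measurable_fun [set: Omega] (fN N)) ->
  (forall w, tame t w -> fN N w @[N --> \oo] --> f w) ->
  (forall w, ~ tame t w -> f w = f0 w) ->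
  measurable_fun [set: Omega] f.
Proof.
move=> m0 mN cN f0E.
have mb : measurable_fun [set: Omega] (fun w => w \in tame t).
  by apply: (measurable_fun_bool true); rewrite setTI preimage_mem_true;
    exact: measurable_tame.
apply: (@measurable_fun_cvg _ _ _ _ (fun N w => if w \in tame t then fN N w else f0 w)).
  by move=> N; apply: measurable_fun_ifT.
move=> w _; case: (boolP (w \in tame t)) => [/set_mem wt|/negP wt].
  exact: cN.
rewrite f0E; first exact: cvg_cst.
by move=> /mem_set.
Qed.

Lemma measurable_mfff_graph t (F : pred (graph n)) : 0 <= t ->
  measurable_fun [set: Omega] (fun w => (F (mfff_graph E L G0 t w))%:R : R).
Proof.
move=> t0; pose fN N w : R := (F (level E L G0 t N t w).1)%:R.
apply: (@measurable_of_levels t _ (fun w => (F (G0 w))%:R) fN).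
- apply: measurable_bool_real; apply: (measurable_fun_bool true); rewrite setTI.
  rewrite (_ : _ @^-1` _ = [set w | F (G0 w)]); last by [].
  by apply: measurable_graph_event => g; exact: (measurable_G0 data).
- move=> N; apply: (measurable_level_state _ _ (fun st => (F st.1)%:R)).
  exact: mesh_ge0.
- move=> w tw; apply: cvg_near_cst.
  by apply: filterS (level_near G0 t0 (lexx t) tw) => N; rewrite /fN => ->.
- by move=> w /mfff_state_wild wt; rewrite /mfff_graph wt.
Qed.

(** The burning times enter through finitely many states only; the initial age
    is added where no burning has occurred. *)
Lemma measurable_level_age t N s i : 0 <= t ->
  measurable_fun [set: Omega] (level_age E L G0 a0 t N s i).
Proof.
move=> t0; have m0 := mesh_ge0 N t0.
rewrite (_ : level_age E L G0 a0 t N s i = fun w =>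
  (if (level E L G0 t N s w).2 i is Some r then s - r else s) +
  ((level E L G0 t N s w).2 i == None)%:R * a0 i w); last first.
  apply/funext => w; rewrite /level_age /age; case: (_ i) => [r|] /=.
    by rewrite mul0r addr0.
  by rewrite mul1r addrC.
apply: measurable_funD.
  exact: (measurable_level_state _ _ (fun st => if st.2 i is Some r then s - r else s)).
apply: measurable_funM; last exact: (measurable_a0 data).
exact: (measurable_level_state _ _ (fun st => (st.2 i == None)%:R)).
Qed.

Lemma measurable_mfffa_age t i : 0 <= t ->
  measurable_fun [set: Omega] (mfffa_age E L G0 a0 t i).
Proof.
move=> t0.
apply: (@measurable_of_levels t _ (fun w => a0 i w + t)
  (fun N => level_age E L G0 a0 t N t i)).
- by apply: measurable_funD; [exact: (measurable_a0 data) | exact: measurable_cst].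
- by move=> N; exact: measurable_level_age.
- by move=> w tw; exact: level_age_cvg.
- by move=> w /mfff_state_wild wt; rewrite /mfffa_age wt ffunE.
Qed.

End Finiteness.

(** * Passing to the limit, and from rectangles to the whole history *)

Section Limit.
Context {d : measure_display} {Omega : measurableType d} {R : realType}.
Variable P : probability Omega R.

Lemma cvg_age_edge_prob n (aN : nat -> 'I_n -> R) (a : 'I_n -> R) e :
  (forall i, aN N i @[N --> \oo] --> a i) ->
  age_edge_prob (aN N) e @[N --> \oo] --> age_edge_prob a e.
Proof.
move=> ca; apply: cvgB; first exact: cvg_cst.
apply: continuous_cvg; first exact: continuous_expR.
apply: cvgN; apply: cvgM; last exact: cvg_cst.
rewrite minr_absE; under eq_fun do rewrite minr_absE.
apply: cvgM; last exact: cvg_cst.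
apply: cvgB; first exact: cvgD.
by apply: cvg_norm; exact: cvgB.
Qed.

Lemma cvg_prod_age n (aN : nat -> 'I_n -> R) (a : 'I_n -> R) (S : {set edge n}) :
  (forall i, aN N i @[N --> \oo] --> a i) ->
  \prod_(e in S) age_edge_prob (aN N) e @[N --> \oo] -->
  \prod_(e in S) age_edge_prob a e.
Proof.
move=> ca; apply: cvg_big => [|e _]; first exact: mul_continuous.
exact: cvg_age_edge_prob.
Qed.

Lemma near_all (T : eqType) (s : seq T) (p : nat -> pred T) (q : pred T) :
  (forall x, x \in s -> \forall N \near \oo, p N x = q x) ->
  \forall N \near \oo, all (p N) s = all q s.
Proof.
elim: s => [|x s IH] h; first by apply: nearW.
have h1 := h x (mem_head x s).
have h2 : \forall N \near \oo, all (p N) s = all q s.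
  by apply: IH => y ys; apply: h; rewrite inE ys orbT.
by apply: filterS2 h1 h2 => N /= -> ->.
Qed.

Lemma integral_unit_cvg (fN : nat -> Omega -> R) (f : Omega -> R) (D : set Omega) :
  (forall N, measurable_fun [set: Omega] (fN N)) -> measurable_fun [set: Omega] f ->
  (forall N w, `|fN N w| <= 1) ->
  measurable D -> P (~` D) = 0%E ->
  (forall w, D w -> fN N w @[N --> \oo] --> f w) ->
  (\int[P]_w (fN N w)%:E)%E @[N --> \oo] --> (\int[P]_w (f w)%:E)%E.
Proof.
move=> mN mf b mD D0 cN.
have [] := @dominated_convergence _ _ _ P setT measurableT
  (fun N w => (fN N w)%:E) (fun w => (f w)%:E) (cst 1%E).
- by move=> N; exact/measurable_EFinP.
- exact/measurable_EFinP.
- exists (~` D); split; [exact: measurableC|exact: D0|].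
  move=> w /= nw Dw; apply: nw => _.
  by apply: cvg_EFin; [apply: nearW | exact: cN].
- by apply: (@bounded_integrable _ _ _ P (cst 1) 1) => // w; rewrite normr1.
- by apply: aeW => w N _; rewrite lee_fin.
by [].
Qed.

(** Dynkin's argument: the sets over which the two integrals agree are stable
    under complement, both total integrals being finite and equal, and under
    disjoint countable unions. *)
Lemma integral_pi_system (G : set (set Omega)) (f1 f2 : Omega -> R) :
  setI_closed G -> G [set: Omega] -> G `<=` measurable ->
  measurable_fun [set: Omega] f1 -> measurable_fun [set: Omega] f2 ->
  (forall w, 0 <= f1 w <= 1) -> (forall w, 0 <= f2 w <= 1) ->
  (forall H, G H -> \int[P]_(w in H) (f1 w)%:E = \int[P]_(w in H) (f2 w)%:E)%E ->
  forall H, <<s G>> H -> (\int[P]_(w in H) (f1 w)%:E = \int[P]_(w in H) (f2 w)%:E)%E.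
Proof.
move=> GI GT Gm m1 m2 b1 b2 E.
have sub : <<s G>> `<=` @measurable _ Omega.
  by apply: smallest_sub => //; exact: sigma_algebra_measurable.
have split (f : Omega -> R) S : measurable_fun [set: Omega] f ->
    (forall w, 0 <= f w <= 1) -> measurable S ->
    (\int[P]_w (f w)%:E = \int[P]_(w in S) (f w)%:E + \int[P]_(w in ~` S) (f w)%:E)%E.
  move=> mf bf mS; rewrite -ge0_integral_setU //.
  - by rewrite setUv.
  - exact: measurableC.
  - by apply: measurable_funTS; exact/measurable_EFinP.
  - by move=> w _; rewrite lee_fin; case/andP: (bf w).
  - by rewrite disj_set2E setICr.
have fin (f : Omega -> R) S : measurable_fun [set: Omega] f ->
    (forall w, 0 <= f w <= 1) -> measurable S ->
    (\int[P]_(w in S) (f w)%:E)%E \is a fin_num.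
  move=> mf bf mS; apply: integrable_fin_num => //.
  apply: (@bounded_integrable _ _ _ P f 1) => // w.
  by case/andP: (bf w) => ? ?; rewrite ger0_norm.
pose T := g_sigma_algebraType G.
apply: (@dynkin_induction _ T G) => //; first exact: E.
  move=> S sS ES; have mS := sub _ sS.
  have := E _ GT; rewrite (split f1 S) // (split f2 S) // ES.
  have fx := fin f2 S m2 b2 mS; rewrite ![(\int[P]_(w in S) _ + _)%E]addeC => eqS.
  by rewrite -[LHS](addeK _ fx) eqS addeK.
move=> F mF tF EF; have mF' k : measurable (F k : set Omega) by exact: (sub _ (mF k)).
rewrite !ge0_integral_bigcup //.
- by apply: eq_eseriesr => k _; exact: EF.
- by apply: measurable_funTS; exact/measurable_EFinP.
- by move=> w _; rewrite lee_fin; case/andP: (b2 w).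
- by apply: measurable_funTS; exact/measurable_EFinP.
- by move=> w _; rewrite lee_fin; case/andP: (b1 w).
Qed.

End Limit.

Section History.
Context {d : measure_display} {Omega : measurableType d} {R : realType}.
Variables (P : probability Omega R) (n : nat) (lambda : R).
Variables (E : Omega -> set (edge n * R)) (L : Omega -> set ('I_n * R)).
Variables (a0 : 'I_n -> Omega -> R) (G0 : Omega -> graph n).
Hypothesis data : mfffa_data P lambda E L a0 G0.
Hypothesis cond0 : cond_age_graph P (sigma_ages a0) G0 a0.
Hypothesis lambda_ge0 : 0 <= lambda.
Variable t : R.
Hypothesis t_ge0 : 0 <= t.

Local Notation A s i := (mfffa_age E L G0 a0 s i).
Local Notation Gt := (mfff_graph E L G0 t).

Lemma level_age_ge0 N i w : 0 <= level_age E L G0 a0 t N t i w.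
Proof.
have := @grid_age_ge0 R n (mesh t N) N.+1 (a0 ^~ w)
  (hit_bits (hits E L (mesh t N) N.+1 w)) (G0 w).
rewrite -meshE /level_age /level ltxx; apply; first exact: mesh_ge0.
  by move=> j; exact: (a0_ge0 data).
by rewrite grid_cells !size_map.
Qed.

Lemma mfffa_age_ge0 i w : 0 <= A t i w.
Proof.
rewrite /mfffa_age; case Eb : (_ i) => [r|]; last by rewrite addr_ge0 ?(a0_ge0 data).
have [tw|/mfff_state_wild wt] := pselect (tame E L t w); last by rewrite wt ffunE in Eb.
move: Eb; rewrite /mfff_state => /last_burn_mem[p].
by rewrite mem_sort in_fset_set // => /set_mem[_ /andP[_ pt]] <-; rewrite subr_ge0.
Qed.

(** Events of this form pass to the limit without exceptional values of the
    bounds, because the approximate ages approach the true ones from below; and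
    strict lower bounds generate the Borel sets. *)
Definition past (cs : seq (R * 'I_n * R)) : set Omega :=
  [set w | all (fun c : R * 'I_n * R => c.2 < A c.1.1 c.1.2 w) cs].

Definition rectangles : set (set Omega) :=
  [set H | exists2 cs : seq (R * 'I_n * R),
     all (fun c : R * 'I_n * R => 0 <= c.1.1 <= t) cs & H = past cs].

Lemma rectangles_setI : setI_closed rectangles.
Proof.
move=> _ _ [cs tcs ->] [cs' tcs' ->]; exists (cs ++ cs'); first by rewrite all_cat tcs.
by apply/seteqP; split=> w; rewrite /past /= all_cat; [move=> [-> ->] | move/andP].
Qed.

Lemma measurable_past (cs : seq (R * 'I_n * R)) :
  all (fun c : R * 'I_n * R => 0 <= c.1.1 <= t) cs -> measurable (past cs).
Proof.
move=> tcs; rewrite -[X in measurable X]setTI.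
suff mp : measurable_fun [set: Omega]
    (fun w => all (fun c : R * 'I_n * R => c.2 < A c.1.1 c.1.2 w) cs).
  by have := mp measurableT [set true]; rewrite /past; apply.
elim: cs tcs => [|c cs IH] /=; first by move=> _; exact: measurable_cst.
case/andP=> /andP[c0 ct] tcs; apply: measurable_and; last exact: IH.
apply: measurable_fun_ltr; first exact: measurable_cst.
exact: (measurable_mfffa_age data).
Qed.

Lemma history_rectangles :
  sigma_age_history (mfffa_age E L G0 a0) t `<=` <<s rectangles>>.
Proof.
pose T := g_sigma_algebraType rectangles.
apply: smallest_sub; first exact: sigma_algebra_measurable T.
move=> _ [s [i [st [B mB ->]]]].
suff ms : measurable_fun [set: T] (A s i : T -> R).
  by have := ms measurableT B mB; rewrite setTI.
apply: (measurability (@RGenOInfty.G R)) => [|_ [_ [x ->] <-]].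
  exact: RGenOInfty.measurableE.
apply: sub_sigma_algebra; exists [:: (s, i, x)]; first by rewrite /= st.
by rewrite setTI; apply/seteqP; split=> w; rewrite /past /= in_itv /= ?andbT.
Qed.

Lemma history_measurable :
  sigma_age_history (mfffa_age E L G0 a0) t `<=` measurable.
Proof.
apply: smallest_sub; first exact: sigma_algebra_measurable.
move=> _ [s [i [/andP[s0 _] [B mB ->]]]]; rewrite -[X in measurable X]setTI.
exact: (measurable_mfffa_age data).
Qed.

Lemma measurable_prod_mfffa_age (S : {set edge n}) :
  measurable_fun [set: Omega]
    (fun w => \prod_(e in S) age_edge_prob (fun i => A t i w) e).
Proof.
apply: (measurable_prod_age S (a := fun i w => A t i w)) => i.
exact: (measurable_mfffa_age data).
Qed.

(** Dominated convergence in [level_law]: almost surely, the approximate events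
    and graphs are eventually the true ones, and the products of edge
    probabilities converge by continuity. *)
Lemma past_law (cs : seq (R * 'I_n * R)) (S : {set edge n}) :
  all (fun c : R * 'I_n * R => 0 <= c.1.1 <= t) cs ->
  (\int[P]_(w in past cs) (S \subset Gt w)%:R%:E =
   \int[P]_(w in past cs) (\prod_(e in S) age_edge_prob (fun i => A t i w) e)%:E)%E.
Proof.
move=> tcs; have mp := measurable_past tcs.
have restrict (f : Omega -> R) :
    (\int[P]_(w in past cs) (f w)%:E = \int[P]_w (\1_(past cs) w * f w)%:E)%E.
  rewrite integral_mkcond; apply: eq_integral => w _.
  by rewrite patchE indicE; case: ifP => _; rewrite ?mul1r ?mul0r.
rewrite !restrict.
pose pastN N w := all (fun c : R * 'I_n * R =>
  c.2 < level_age E L G0 a0 t N c.1.1 c.1.2 w) cs.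
pose qN N w := \prod_(e in S) age_edge_prob (level_age E L G0 a0 t N t ^~ w) e.
pose gN N w : R := (S \subset (level E L G0 t N t w).1)%:R.
have lawN N : (\int[P]_w ((pastN N w)%:R * gN N w)%:E =
    \int[P]_w ((pastN N w)%:R * qN N w)%:E)%E.
  have m0 := mesh_ge0 N t_ge0.
  pose k s := if s < t then round_index (mesh t N) N.+1 s else N.+1.
  have /= := level_law data cond0 N.+1 lambda_ge0 m0
    [seq (k c.1.1, c.1.1, c.1.2, c.2) | c <- cs] S.
  rewrite -meshE => law.
  have pE w : all (fun c : nat * R * 'I_n * R => c.2 < age (a0 ^~ w)
      (level_state E L G0 (mesh t N) N.+1 (minn c.1.1.1 N.+1) w).2 c.1.1.2 c.1.2)
      [seq (k c.1.1, c.1.1, c.1.2, c.2) | c <- cs] = pastN N w.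
    rewrite all_map; apply: eq_all => c /=; rewrite (minn_idPl _) //.
    by rewrite /k; case: ifP => // _; exact: round_index_le.
  apply: etrans (etrans _ law) _; apply: eq_integral => w _; rewrite pE.
    by rewrite /gN /level ltxx.
  by rewrite /qN /level_age /level ltxx.
have mpastN N : measurable_fun [set: Omega] (fun w => (pastN N w)%:R : R).
  apply: measurable_bool_real; apply: measurable_all => c.
  apply: measurable_fun_ltr; first exact: measurable_cst.
  exact: (measurable_level_age data).
have cpast w : tame E L t w -> (pastN N w)%:R @[N --> \oo] --> (\1_(past cs) w : R).
  move=> tw; apply: cvg_near_cst.
  have : \forall N \near \oo, pastN N w = all (fun c : R * 'I_n * R =>
      c.2 < A c.1.1 c.1.2 w) cs.
    apply: near_all => c /(allP tcs) /andP[c0 ct].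
    exact: level_age_gt_near.
  apply: filterS => N ->; rewrite indicE; congr (_%:R); congr nat_of_bool.
  by apply/idP/idP => [?|/set_mem//]; exact/mem_set.
have lim (fN : nat -> Omega -> R) (f : Omega -> R) :
    (forall N, measurable_fun [set: Omega] (fN N)) -> measurable_fun [set: Omega] f ->
    (forall N w, `|fN N w| <= 1) ->
    (forall w, tame E L t w -> fN N w @[N --> \oo] --> f w) ->
    (\int[P]_w ((pastN N w)%:R * fN N w)%:E)%E @[N --> \oo] -->
    (\int[P]_w (\1_(past cs) w * f w)%:E)%E.
  move=> mfN mf b cf.
  apply: (integral_unit_cvg (D := tame E L t)).
  - by move=> N; exact: measurable_funM.
  - by apply: measurable_funM => //; exact: measurable_indic.
  - by move=> N w; rewrite normrM normr_nat mulr_ile1 // ?ler_nat; case: (pastN N w).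
  - exact: (measurable_tame data).
  - exact: (ae_tame data).
  - by move=> w tw; apply: cvgM; [exact: cpast | exact: cf].
have l1 : (\int[P]_w ((pastN N w)%:R * gN N w)%:E)%E @[N --> \oo] -->
    (\int[P]_w (\1_(past cs) w * (S \subset Gt w)%:R)%:E)%E.
  apply: lim.
  - move=> N; apply: (measurable_level_state data _ _ (fun st => (S \subset st.1)%:R)).
    exact: mesh_ge0.
  - exact: (measurable_mfff_graph data (fun g => S \subset g) t_ge0).
  - by move=> N w; rewrite normr_nat /gN; case: (S \subset _).
  - move=> w tw; apply: cvg_near_cst.
    by apply: filterS (level_near G0 t_ge0 (lexx t) tw) => N; rewrite /gN => ->.
have l2 : (\int[P]_w ((pastN N w)%:R * qN N w)%:E)%E @[N --> \oo] -->
    (\int[P]_w (\1_(past cs) w *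
       \prod_(e in S) age_edge_prob (fun i => A t i w) e)%:E)%E.
  apply: lim.
  - move=> N; apply: (measurable_prod_age S (a := level_age E L G0 a0 t N t)) => i.
    exact: (measurable_level_age data).
  - exact: measurable_prod_mfffa_age.
  - move=> N w; have /andP[q0 q1] := prod_age_edge_prob_itv S
      (fun i => level_age_ge0 N i w).
    by rewrite ger0_norm.
  - by move=> w tw; apply: cvg_prod_age => i; exact: level_age_cvg.
apply: (cvg_unique _ l1) => //.
suff -> : (fun N => \int[P]_w ((pastN N w)%:R * gN N w)%:E)%E =
  (fun N => \int[P]_w ((pastN N w)%:R * qN N w)%:E)%E by [].
by apply/funext => N; exact: lawN.
Qed.

End History.

Theorem theorem2p6 (d : measure_display) (Omega : measurableType d)
    (R : realType) (P : probability Omega R) (n : nat) (lambda : R)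
    (E : Omega -> set (edge n * R)) (L : Omega -> set ('I_n * R))
    (a0 : 'I_n -> Omega -> R) (G0 : Omega -> graph n) :
  (1 <= n)%N -> 0 < lambda ->
  mfffa_data P lambda E L a0 G0 ->
  cond_age_graph P (sigma_ages a0) G0 a0 ->
  forall t : R, 0 <= t ->
    cond_age_graph P (sigma_age_history (mfffa_age E L G0 a0) t)
      (mfff_graph E L G0 t) (mfffa_age E L G0 a0 t).

Proof.
move=> _ lambda_gt0 data cond0 t t_ge0 S; have lambda_ge0 := ltW lambda_gt0.
have mage := measurable_prod_mfffa_age data t_ge0 S.
have evE : \bigcap_(e in [set` S]) [set w | e \in mfff_graph E L G0 t w] =
    [set w | S \subset mfff_graph E L G0 t w].
  apply/seteqP; split=> w /= h; first by apply/fintype.subsetP => e; exact: h.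
  by move=> e eS; exact: (fintype.subsetP h).
have mS : measurable [set w | S \subset mfff_graph E L G0 t w].
  have := measurable_mfff_graph data (fun g => S \subset g) t_ge0 measurableT
    (measurable_set1 (1 : R)).
  rewrite setTI; congr measurable; apply/seteqP; split=> w /=; last by move=> ->.
  by case: (S \subset _) => //= /esym/eqP; rewrite oner_eq0.
rewrite evE; split=> //; first exact: (history_measurable data).
  pose T := g_sigma_algebraType [set H | exists s i, 0 <= s <= t /\
    exists2 B, measurable B & H = mfffa_age E L G0 a0 s i @^-1` B].
  move=> B mB.
  have mq : measurable_fun [set: T]
      (fun w => \prod_(e in S) age_edge_prob (mfffa_age E L G0 a0 t ^~ w) e).
    apply: (measurable_prod_age (T := T) S) => i _ B' mB'; rewrite setTI.
    apply: sub_sigma_algebra; exists t, i; rewrite lexx t_ge0; split=> //.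
    by exists B'.
  by have := mq measurableT B mB; rewrite setTI.
move=> H HF.
have mH := history_measurable data HF.
rewrite -[LHS](integral_indic P mH mS).
have indS w : \1_[set w | S \subset mfff_graph E L G0 t w] w =
    (S \subset mfff_graph E L G0 t w)%:R :> R.
  rewrite indicE; congr (nat_of_bool _)%:R.
  by apply/idP/idP => [/set_mem//|?]; exact/mem_set.
under eq_integral do rewrite indS.
apply: (@integral_pi_system _ _ _ P (rectangles E L a0 G0 t)).
- exact: rectangles_setI.
- by exists [::] => //; apply/seteqP; split.
- by move=> _ [cs tcs ->]; exact: (measurable_past data tcs).
- exact: (measurable_mfff_graph data (fun g => S \subset g) t_ge0).
- exact: mage.
- by move=> w; case: (S \subset _); rewrite ?lexx ler01.
- by move=> w; apply: prod_age_edge_prob_itv => i; exact: (mfffa_age_ge0 data).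
- by move=> _ [cs tcs ->]; exact: (past_law data cond0 lambda_ge0 t_ge0).
- exact: history_rectangles.
Qed.
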